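(* Periodic points are dense in $\partial U$; that is, the set of periodic points of $f$ lying in $\partial U$ is dense in $\partial U$.
   Context: Let $f(z)=z+e^{-z}$. A Baker domain is a periodic Fatou component on which the iterates converge locally uniformly to $\infty$. Let $U$ be the unique Baker domain of $f$ contained in the strip $S=\{z\in\mathbb{C}: |\mathrm{Im}\,z|\le\pi\}$; it satisfies $f(U)\subset U$ and contains $\mathbb{R}$. $\partial U$ is its boundary in $\mathbb{C}$. *)

(* Defs.v *)
From HB Require Import structures.
From mathcomp Require Import all_boot all_order all_algebra.
From mathcomp Require Import complex.
From mathcomp Require Import all_classical all_reals all_analysis.

Set Implicit Arguments.
Unset Strict Implicit.
Unset Printing Implicit Defensive.

Import Order.TTheory GRing.Theory Num.Theory.
Import numFieldNormedType.Exports.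

Local Open Scope classical_set_scope.
Local Open Scope ring_scope.
Local Open Scope complex_scope.

(* [R[i]] as a normed space over itself: the norm on [R[i]] is the modulus, so
   the topology is the usual one of the plane. *)
HB.instance Definition _ (R : realType) :=
  NormedModule.copy R[i] ((R[i] : numFieldType)^o).

Section ComplexDynamics.
Variable R : realType.
Local Notation C := R[i].

Definition cexp (z : C) : C :=
  let: x +i* y := z in (expR x * cos y) +i* (expR x * sin y).

(* [None] is the point at infinity. *)
Definition riemann_sphere := option C.

Definition modulus (z : C) : R := complex.Re `|z|.

Definition chordal_dist (p q : riemann_sphere) : R :=
  match p, q with
  | Some z, Some w =>
      2 * modulus (z - w)
        / (Num.sqrt (1 + modulus z ^+ 2) * Num.sqrt (1 + modulus w ^+ 2))
  | Some z, None | None, Some z => 2 / Num.sqrt (1 + modulus z ^+ 2)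
  | None, None => 0
  end.

Definition cvg_locally_uniformly (A : set C)
    (g_ : nat -> C -> riemann_sphere) (g : C -> riemann_sphere) : Prop :=
  forall z, A z -> exists2 V : set C, nbhs z V &
    forall e : R, 0 < e ->
      \forall n \near \oo, forall w, A w -> V w -> chordal_dist (g_ n w) (g w) < e.

Section Iteration.
Variable g : C -> C.

Definition iterate_to_sphere (n : nat) (z : C) : riemann_sphere :=
  Some (iter n g z).

(* The limit functions are sphere-valued, so that the constant infinity is
   allowed. *)
Definition iterates_normal_on (V : set C) : Prop :=
  forall m : nat -> nat, exists k : nat -> nat,
    {homo k : i j / (i < j)%N} /\
    exists h : C -> riemann_sphere,
      cvg_locally_uniformly V (fun j => iterate_to_sphere (m (k j))) h.

Definition fatou_set : set C :=
  [set z | exists V : set C, [/\ open V, V z & iterates_normal_on V]].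

Definition fatou_component (U : set C) : Prop :=
  exists2 z, fatou_set z & U = connected_component fatou_set z.

Definition baker_domain (U : set C) : Prop :=
  [/\ fatou_component U,
      exists2 p : nat, (0 < p)%N & iter p g @` U `<=` U
    & cvg_locally_uniformly U iterate_to_sphere (fun=> None)].

Definition periodic_point : set C :=
  [set z | exists2 p : nat, (0 < p)%N & iter p g z = z].

End Iteration.

Definition boundary (A : set C) : set C := closure A `\` interior A.

Definition f (z : C) : C := z + cexp (- z).

Definition strip : set C := [set z | `|complex.Im z| <= pi].

End ComplexDynamics.

(* Main.v *)
Require Import Defs.
From mathcomp Require Import all_boot all_order all_algebra.
From mathcomp Require Import complex.
From mathcomp Require Import all_classical all_reals all_analysis.
From mathcomp Require Import ring lra.

(** Write z = x + iy. The change of variable w = exp(-z) turns f into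
    w exp(-w), whose parabolic fixed point 0 corresponds to the Baker domain,
    and f'(z) = 1 - w. The disc |w - 1| < 1, tangent to 0, is the set
    exp(x) cos y > 1/2; inside the strip it is the [petal]. The petal is
    forward invariant and its points escape to infinity, while off the petal
    |f'| >= 1. So the Euclidean metric itself is expanded, though not uniformly,
    on the part of the strip that never enters the petal.

    Let [basin] be the set of points whose orbit stays in the open strip and
    enters the petal, and let J be the set of points of the closed strip whose
    orbit stays in the strip and never enters the petal. The closure of the
    basin is the union of the basin and J.

    Inverse branches. f covers the strip twice, with critical value 1, so
    off the ray [1, +oo) it has one inverse branch with values in each half of
    the strip ([branch] and its conjugate). Folding the strip by
    conjugation puts everything on the single set [half_julia], the upper half
    of the strip minus the petal, which both folded branches [hbranch] map
    into itself. Any two points of this set are joined in it by a horizontal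
    and a vertical segment, so a bound on local Lipschitz constants gives a
    bound on distances ([path_lipschitz]).

    Contraction. An orbit in J returns infinitely often to Re z < 0
    ([julia_orbit_return]), and at bounded distance from such a return f'
    has modulus at least some k > 1 ([fderiv_uniform]); so the inverse branches
    along the orbit of z contract any ball of fixed radius around f^n(z) to a
    set of arbitrarily small diameter ([itinerary_contracts]). On the other
    hand, some finite composition of inverse branches maps z to within a bounded
    distance of any given point of J ([backward_orbit_Re_dense]).
    Composing the two gives a contraction of a small neighbourhood of z, and
    its fixed point is a periodic point in J near z ([periodic_near]). The same
    contraction applied to a basin point close to f^n(z) shows that J
    lies in the closure of the basin ([julia_orbit_closure]).

    It remains to see that the basin is a Baker domain in the strip, so that it
    is U. It is open and connected ([basin_connected]), its points
    escape locally uniformly, and no point of its frontier is in the Fatou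
    set: near such a point there is a periodic point, of bounded orbit, that is a
    limit of escaping points, which rules out normality
    ([frontier_not_normal]). Hence the basin is a whole Fatou component, and
    its boundary is J, in which periodic points are dense. *)

Set Implicit Arguments.
Unset Strict Implicit.
Unset Printing Implicit Defensive.

Import Order.TTheory GRing.Theory Num.Theory.
Import numFieldNormedType.Exports.

Local Open Scope classical_set_scope.
Local Open Scope ring_scope.
Local Open Scope complex_scope.

(** * The plane in real coordinates *)

Section Plane.
Variable R : realType.
Local Notation C := R[i].
Local Notation re := (@complex.Re R).
Local Notation im := (@complex.Im R).
Implicit Types (z w : C) (e : R).

Lemma modulusE z : modulus z = Num.sqrt (re z ^+ 2 + im z ^+ 2).
Proof. by rewrite /modulus normc_def. Qed.

Lemma modulus_norm z : `|z| = (modulus z)%:C.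
Proof. by rewrite modulusE normc_def. Qed.

Lemma modulus_ge0 z : 0 <= modulus z.
Proof. by rewrite modulusE sqrtr_ge0. Qed.

Lemma modulusN z : modulus (- z) = modulus z.
Proof. by rewrite /modulus normrN. Qed.

Lemma modulusB z w : modulus (z - w) = modulus (w - z).
Proof. by rewrite -modulusN opprB. Qed.

Lemma modulusM z w : modulus (z * w) = modulus z * modulus w.
Proof. by apply: (@complexI R); rewrite rmorphM -!modulus_norm normrM. Qed.

Lemma modulusD z w : modulus (z + w) <= modulus z + modulus w.
Proof. by rewrite -lecR rmorphD -!modulus_norm ler_normD. Qed.

Lemma modulus0 : modulus (0 : C) = 0.
Proof. by rewrite /modulus normr0. Qed.

Lemma modulus_eq0 z : modulus z = 0 -> z = 0.
Proof. by move=> h; apply/eqP; rewrite -normr_eq0 modulus_norm h. Qed.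

Lemma modulus_conj z : modulus (z^*) = modulus z.
Proof. by case: z => a b; rewrite !modulusE /= sqrrN. Qed.

Lemma abs_Re_le z : `|re z| <= modulus z.
Proof.
by rewrite modulusE -sqrtr_sqr ler_wsqrtr // lerDl sqr_ge0.
Qed.

Lemma abs_Im_le z : `|im z| <= modulus z.
Proof.
by rewrite modulusE -sqrtr_sqr ler_wsqrtr // lerDr sqr_ge0.
Qed.

Lemma modulus_le z : modulus z <= `|re z| + `|im z|.
Proof.
rewrite modulusE -[leRHS]ger0_norm ?addr_ge0// -sqrtr_sqr ler_wsqrtr //.
rewrite sqrrD !real_normK ?num_real// -addrA lerD2l lerDr.
by rewrite mulrn_wge0 ?mulr_ge0.
Qed.

Lemma ReD z w : re (z + w) = re z + re w. Proof. by case: z; case: w. Qed.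
Lemma ImD z w : im (z + w) = im z + im w. Proof. by case: z; case: w. Qed.
Lemma ReN z : re (- z) = - re z. Proof. by case: z. Qed.
Lemma ImN z : im (- z) = - im z. Proof. by case: z. Qed.
Lemma ReB z w : re (z - w) = re z - re w. Proof. by rewrite ReD ReN. Qed.
Lemma ImB z w : im (z - w) = im z - im w. Proof. by rewrite ImD ImN. Qed.

Lemma nbhs_modulusP z (V : set C) :
  nbhs z V <-> exists2 e : R, 0 < e & forall w, modulus (w - z) < e -> V w.
Proof.
split=> [/nbhs_ballP[e /= e0 h]|[e e0 h]].
  have e1 : e = (re e)%:C by rewrite RRe_real // gtr0_real.
  exists (re e); first by rewrite -ltcR -e1.
  move=> w hw; apply: h; rewrite -ball_normE /= distrC modulus_norm e1.
  by rewrite ltcR.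
apply/nbhs_ballP; exists (e%:C) => /=; first by rewrite ltcR.
move=> w; rewrite -ball_normE /= distrC modulus_norm ltcR; exact: h.
Qed.

Lemma closure_modulusP z (A : set C) :
  closure A z <-> forall e, 0 < e -> exists2 w, A w & modulus (w - z) < e.
Proof.
split=> [h e e0|h V /nbhs_modulusP[e e0 hV]].
  have /h[w [Aw hw]] : nbhs z [set w | modulus (w - z) < e].
    by apply/nbhs_modulusP; exists e.
  by exists w.
by have [w Aw hw] := h e e0; exists w; split => //; exact: hV.
Qed.

Lemma continuous_modulusP (g : C -> R) :
  (forall z e, 0 < e -> exists2 d : R, 0 < d &
     forall w, modulus (w - z) < d -> `|g z - g w| < e) -> continuous g.
Proof.
move=> h z V /nbhs_ballP[e /= e0 hV]; have [d d0 hd] := h z e e0.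
by apply/nbhs_modulusP; exists d => // w /hd; exact: hV.
Qed.

Lemma Re_continuous : continuous re.
Proof.
apply: continuous_modulusP => z e e0; exists e => // w.
by apply: le_lt_trans; rewrite -ReB modulusB abs_Re_le.
Qed.

Lemma Im_continuous : continuous im.
Proof.
apply: continuous_modulusP => z e e0; exists e => // w.
by apply: le_lt_trans; rewrite -ImB modulusB abs_Im_le.
Qed.

Lemma continuous_distance (c : C) : continuous (fun z => modulus (z - c)).
Proof.
apply: continuous_modulusP => z e e0; exists e => // w h.
apply: le_lt_trans h; rewrite ler_norml; apply/andP; split.
  have := modulusD (w - z) (z - c); rewrite addrA subrK; lra.
have := modulusD (z - w) (w - c); rewrite addrA subrK [modulus (z - w)]modulusB; lra.
Qed.

Lemma Complex_continuous (T : topologicalType) (F : set_system T) (FF : Filter F)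
    (a b : T -> R) (l m : R) :
  a x @[x --> F] --> l -> b x @[x --> F] --> m ->
  (a x +i* b x) @[x --> F] --> (l +i* m).
Proof.
move=> /cvgrPdist_lt ha /cvgrPdist_lt hb V /nbhs_modulusP[e e0 hV].
have e2 : 0 < e / 2 by rewrite divr_gt0.
suff : \forall x \near F, V (a x +i* b x) by [].
near=> x; apply: hV; apply: le_lt_trans (modulus_le _) _ => /=.
have h1 : `|l - a x| < e / 2 by near: x; exact: ha.
have h2 : `|m - b x| < e / 2 by near: x; exact: hb.
by rewrite (distrC (a x)) (distrC (b x)); lra.
Unshelve. all: by end_near. Qed.

Lemma continuous_Complex (T : topologicalType) (a b : T -> R) :
  continuous a -> continuous b -> continuous (fun x => a x +i* b x).
Proof. by move=> ha hb x; apply: Complex_continuous; [exact: ha|exact: hb]. Qed.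

Lemma conj_continuous : continuous (@conjc R).
Proof.
have -> : @conjc R = fun z => re z +i* (- im z) by apply/funext; case.
apply: continuous_Complex; first exact: Re_continuous.
apply: continuous_modulusP => z e e0; exists e => // w.
by apply: le_lt_trans; rewrite opprK addrC -ImB abs_Im_le.
Qed.

Definition rect (a b c d : R) : set C := [set z | a <= re z <= b /\ c <= im z <= d].

Lemma rect_compact a b c d : compact (rect a b c d).
Proof.
pose g (p : R * R) : C := p.1 +i* p.2.
have -> : rect a b c d = g @` (`[a, b]%classic `*` `[c, d]%classic).
  apply/seteqP; split=> [[x y]/= [hx hy]|z [[x y]/= [hx hy] <-]].
    by exists (x, y) => //=; rewrite !in_itv.
  by move: hx hy; rewrite /= !in_itv.
apply: continuous_compact.
  apply: continuous_subspaceT; apply: continuous_Complex => p.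
    exact: cvg_fst.
  exact: cvg_snd.
by apply: compact_setX; exact: segment_compact.
Qed.

Lemma compact_pos_min (K : set C) (g : C -> R) :
  compact K -> {within K, continuous g} -> (forall z, K z -> 0 < g z) ->
  exists2 m : R, 0 < m & forall z, K z -> m <= g z.
Proof.
move=> cK cg gp; have [[z0 Kz0]|K0] := pselect (K !=set0); last first.
  by exists 1 => // z Kz; exfalso; apply: K0; exists z.
have [c cK' hc] := compact_EVT_min (ex_intro _ z0 Kz0) cK cg.
exists (g c) => [|z Kz]; first by apply: gp; rewrite inE in cK'.
by apply: hc; rewrite inE.
Qed.

(** Apply the extreme value theorem to the sum of the positive parts of the
    two functions. *)
Lemma compact_pos_min2 (K : set C) (g1 g2 : C -> R) : compact K ->
  continuous g1 -> continuous g2 -> (forall z, K z -> 0 < g1 z \/ 0 < g2 z) ->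
  exists2 m : R, 0 < m & forall z, K z -> m <= g1 z \/ m <= g2 z.
Proof.
move=> cK c1 c2 h; pose g z := (g1 z + `|g1 z|) + (g2 z + `|g2 z|).
have cg : continuous g.
  have ca (u : C -> R) : continuous u -> continuous (fun z => u z + `|u z|).
    move=> cu z; apply: (@continuousD R R C); first exact: cu.
    by apply: (@continuous_comp C R R u (fun x => `|x|)); [exact: cu|exact: norm_continuous].
  by move=> z; apply: (@continuousD R R C); exact: ca.
have [|z Kz|m m0 hm] := @compact_pos_min K g cK; first exact: continuous_subspaceT.
  rewrite /g; have := ler_norm (- g1 z); have := ler_norm (- g2 z).
  have := ler_norm (g1 z); have := ler_norm (g2 z).
  by rewrite !normrN; have [] := h z Kz; lra.
exists (m / 4) => [|z Kz]; first by lra.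
have := hm z Kz; rewrite /g.
have [g1p|g1n] := leP 0 (g1 z); have [g2p|g2n] := leP 0 (g2 z).
- have [le|lt] := leP (m / 4) (g1 z); first by left.
  by rewrite !ger0_norm //; right; lra.
- by rewrite (ger0_norm g1p) (ltr0_norm g2n); left; lra.
- by rewrite (ger0_norm g2p) (ltr0_norm g1n); right; lra.
- by rewrite (ltr0_norm g2n) (ltr0_norm g1n); lra.
Qed.

(** * The map and its local expansion *)

Lemma sin_MVT (y : R) : 0 < y -> exists2 c, 0 < c < y & sin y = y * cos c.
Proof.
move=> y0; have [|c] := @MVT R sin cos 0 y y0 (fun x _ => is_derive_sin x).
  by apply: continuous_subspaceT => x; exact: continuous_sin.
by rewrite in_itv /= => hc; rewrite sin0 !subr0 mulrC => h; exists c.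
Qed.

Lemma sin_le_id (y : R) : 0 <= y -> sin y <= y.
Proof.
rewrite le_eqVlt => /predU1P[<-|y0]; first by rewrite sin0.
have [c _ ->] := sin_MVT y0; have := cos_le1 c; nra.
Qed.

Lemma abs_sin_le (y : R) : `|sin y| <= `|y|.
Proof.
wlog y0 : y / 0 <= y => [H|].
  have [|/ltW h] := leP 0 y; first exact: H.
  by rewrite -[sin y]opprK -sinN normrN -[`|y|]normrN H // oppr_ge0.
have h := sin_le_id y0; have y1 : 0 <= y ^+ 2 by rewrite sqr_ge0.
rewrite (ger0_norm y0) ler_norml h andbT.
have [le1|lt1] := leP y 1; last by have := sin_geN1 y; lra.
suff : 0 <= sin y by lra.
by apply: sin_ge0_pi; rewrite y0 /=; have := pi_ge2 R; lra.
Qed.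

Lemma one_minus_cos_le (y : R) : 1 - cos y <= y ^+ 2 / 2.
Proof.
have [h ->] : exists h, y = h *+ 2 by exists (y / 2); rewrite mulr2n; lra.
rewrite cos_mulr2n; have := cos2Dsin2 h.
have := abs_sin_le h; rewrite -(ler_sqr (x := `|_|)) ?nnegrE //.
rewrite !real_normK ?num_real //; nra.
Qed.

(** The mean value theorem reduces the gap sin y - y to y (1 - cos c). *)
Lemma abs_sin_sub_le (y : R) : `|sin y - y| <= `|y| * y ^+ 2.
Proof.
wlog y0 : y / 0 <= y => [H|].
  have [|/ltW h] := leP 0 y; first exact: H.
  have := H (- y); rewrite oppr_ge0 => /(_ h).
  by rewrite sinN sqrrN normrN opprK addrC distrC.
move: y0; rewrite le_eqVlt => /predU1P[<-|y0].
  by rewrite sin0 subr0 normr0 mul0r.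
have [c /andP[c0 cy] ->] := sin_MVT y0.
rewrite -{2}[y]mulr1 -mulrBr normrM ler_wpM2l // ler_norml.
have := one_minus_cos_le c; have := cos_le1 c.
have : c ^+ 2 <= y ^+ 2 by rewrite ler_sqr ?nnegrE; lra.
have := sqr_ge0 c; lra.
Qed.

(** The upper bound comes from exp a <= 1 / (1 - a), which is the tangent
    bound at -a inverted. *)
Lemma abs_expR_sub_le (a : R) : `|a| <= 1 / 2 -> `|expR a - 1 - a| <= 2 * a ^+ 2.
Proof.
rewrite ler_norml => /andP[h1 h2]; have p := expR_gt0 a.
have l := expR_ge1Dx a; have := expR_ge1Dx (- a).
have := expRxMexpNx_1 a; set E := expR a in p l *; set E' := expR (- a).
move=> EE l'; rewrite ger0_norm; last lra.
have : E * (1 - a) <= E * E' by rewrite ler_pM2l.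
rewrite EE => h3; have s := sqr_ge0 a; nra.
Qed.

(** This is the real part of exp z, that is of 1/w for w = exp(-z). *)
Definition reexp z : R := expR (re z) * cos (im z).

Lemma Re_f z : re (f z) = re z + expR (- re z) * cos (im z).
Proof. by case: z => a b; rewrite /f /cexp /= cosN. Qed.

Lemma Im_f z : im (f z) = im z - expR (- re z) * sin (im z).
Proof. by case: z => a b; rewrite /f /cexp /= sinN mulrN. Qed.

Lemma Re_conj z : re (z^*) = re z. Proof. by case: z. Qed.
Lemma Im_conj z : im (z^*) = - im z. Proof. by case: z. Qed.

Lemma f_conj z : f (z^*) = (f z)^*.
Proof.
apply/eqP; rewrite eq_complex Re_f Im_f !Re_conj !Im_conj Re_f Im_f.
by rewrite sinN cosN mulrN opprK opprB (addrC (- im z)) !eqxx.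
Qed.

Lemma iter_f_conj n z : iter n (@f R) (z^*) = (iter n (@f R) z)^*.
Proof. by elim: n => //= n ->; rewrite f_conj. Qed.

Lemma cexpD z w : cexp (z + w) = cexp z * cexp w.
Proof.
case: z => a b; case: w => c d; rewrite /cexp /=.
by apply/eqP; rewrite eq_complex /= expRD sinD cosD; apply/andP; split; apply/eqP; ring.
Qed.

Lemma modulus_cexp z : modulus (cexp z) = expR (re z).
Proof.
case: z => a b; rewrite modulusE /= !exprMn -mulrDr cos2Dsin2 mulr1.
by rewrite sqrtr_sqr ger0_norm ?expR_ge0.
Qed.

Lemma continuous_f : continuous (@f R).
Proof.
have -> : @f R = fun z => (re z + expR (- re z) * cos (im z)) +i*
    (im z - expR (- re z) * sin (im z)).
  by apply/funext => z; apply/eqP; rewrite eq_complex /= Re_f Im_f !eqxx.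
have cE : continuous (fun z : C => expR (- re z)).
  move=> z; apply: (@continuous_comp C R R (fun z => - re z) expR).
    by apply: (@continuousN R R C re z); exact: Re_continuous.
  exact: continuous_expR.
apply: continuous_Complex => z.
  apply: (@continuousD R R C); first exact: Re_continuous.
  apply: (@continuousM R C); first exact: cE.
  by apply: continuous_comp; [exact: Im_continuous|exact: continuous_cos].
apply: (@continuousB R R C); first exact: Im_continuous.
apply: (@continuousM R C); first exact: cE.
by apply: continuous_comp; [exact: Im_continuous|exact: continuous_sin].
Qed.

Lemma continuous_reexp : continuous reexp.
Proof.
move=> z; apply: (@continuousM R C).
  by apply: continuous_comp; [exact: Re_continuous|exact: continuous_expR].
by apply: continuous_comp; [exact: Im_continuous|exact: continuous_cos].
Qed.

Lemma continuous_iter_f n : continuous (iter n (@f R)).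
Proof.
elim: n => [|n IH] z; first exact: cvg_id.
apply: (@continuous_comp C C C (iter n (@f R)) (@f R) z); first exact: IH.
exact: continuous_f.
Qed.

Definition fderiv z : C := 1 - cexp (- z).

(** Expanding |1 - exp(-z)|^2 shows that |f'| >= 1 exactly where [reexp] is at
    most 1/2. *)
Lemma modulus_fderiv_sqr z :
  modulus (fderiv z) ^+ 2 = 1 + expR (- re z) ^+ 2 * (1 - 2 * reexp z).
Proof.
rewrite modulusE sqr_sqrtr ?addr_ge0 ?sqr_ge0 //.
have := expRxMexpNx_1 (re z); rewrite /reexp.
case: z => a b /=; rewrite cosN sinN => h.
have := cos2Dsin2 b; set E := expR (- a) in h *; set E' := expR a in h *.
move=> cs; transitivity (1 - 2 * E * cos b + E ^+ 2 * (cos b ^+ 2 + sin b ^+ 2)).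
  ring.
rewrite cs; transitivity (1 - 2 * E * cos b * (E' * E) + E ^+ 2); last ring.
by rewrite h; ring.
Qed.

Lemma modulus_cexp_sub_le (h : C) : modulus h <= 1 / 2 ->
  modulus (cexp (- h) - 1 + h) <= 4 * modulus h ^+ 2.
Proof.
move=> hm; have m2 : modulus h ^+ 2 = re h ^+ 2 + im h ^+ 2.
  by rewrite modulusE sqr_sqrtr ?addr_ge0 ?sqr_ge0.
have ha := le_trans (abs_Re_le h) hm; have hb := le_trans (abs_Im_le h) hm.
rewrite m2; case: h {hm m2} ha hb => a b /= ha hb.
apply: le_trans (modulus_le _) _ => /=; rewrite cosN sinN.
have := @abs_expR_sub_le (- a); rewrite normrN => /(_ ha); rewrite sqrrN opprK.
have := abs_sin_sub_le b; have := one_minus_cos_le b.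
have c1 := cos_le1 b; have := cos_max b; have := abs_sin_le b.
set E := expR (- a); set c := cos b in c1 *; set s := sin b.
move=> hs hc hc2 hs2 hE.
have a2 : `|a| ^+ 2 = a ^+ 2 by rewrite real_normK ?num_real.
have b2 : `|b| ^+ 2 = b ^+ 2 by rewrite real_normK ?num_real.
have na := normr_ge0 a; have nb := normr_ge0 b.
have t1 : `|E * c - 1 + a| <= 2 * a ^+ 2 + b ^+ 2.
  have -> : E * c - 1 + a = (E - 1 + a) * c - (1 - a) * (1 - c) by ring.
  apply: le_trans (ler_normB _ _) _; rewrite !normrM.
  have : `|E - 1 + a| * `|c| <= 2 * a ^+ 2.
    rewrite -[leRHS]mulr1; apply: ler_pM => //.
  have : `|1 - a| <= 3 / 2 by have := ler_normB 1 a; rewrite normr1; lra.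
  have : `|1 - c| <= b ^+ 2 / 2 by rewrite ger0_norm; lra.
  have := normr_ge0 (1 - a); have := normr_ge0 (1 - c); nra.
have t2 : `|0 - E * s + b| <= a ^+ 2 + 2 * b ^+ 2.
  have -> : 0 - E * s + b = - ((E - 1) * s + (s - b)) by ring.
  rewrite normrN; apply: le_trans (ler_normD _ _) _; rewrite !normrM.
  have : `|E - 1| <= 2 * `|a|.
    have -> : E - 1 = (E - 1 + a) - a by ring.
    by apply: le_trans (ler_normB _ _) _; nra.
  move=> u; have u1 : `|E - 1| * `|s| <= 2 * `|a| * `|b| by apply: ler_pM.
  have u2 := sqr_ge0 (`|a| - `|b|); have u3 : `|b| * b ^+ 2 <= b ^+ 2 / 2 by nra.
  by nra.
have -> : E * - s - 0 + b = 0 - E * s + b by ring.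
by have := sqr_ge0 a; have := sqr_ge0 b; lra.
Qed.

(** The remainder of f at z is exp(-z) (exp(-h) - 1 + h), which is quadratic
    in h. Being a lower bound on the distance of images, this statement
    transfers to inverse branches as a Lipschitz bound, without
    differentiating them. *)
Lemma f_local_expansion z (k : R) : k < modulus (fderiv z) ->
  exists2 d : R, 0 < d & forall w, modulus (w - z) < d ->
    k * modulus (w - z) <= modulus (f w - f z).
Proof.
move=> hk; set m := modulus (fderiv z) in hk; have p := expR_gt0 (- re z).
have p4 : 0 < 4 * expR (- re z) by lra.
exists (Num.min (1 / 2) ((m - k) / (4 * expR (- re z)))).
  by rewrite lt_min; apply/andP; split; [lra|rewrite divr_gt0 ?subr_gt0].
move=> w; rewrite lt_min (ltr_pdivlMr _ (m - k)) // => /andP[h1 h2].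
set h := w - z in h1 h2 *.
have E : f w - f z = h * fderiv z + cexp (- z) * (cexp (- h) - 1 + h).
  have -> : w = z + h by rewrite /h addrC subrK.
  by rewrite /f opprD cexpD /fderiv; ring.
have h3 : modulus h <= 1 / 2 by lra.
have b := modulus_cexp_sub_le h3.
have t := modulusD (f w - f z) (- (cexp (- z) * (cexp (- h) - 1 + h))).
have Eh : f w - f z - cexp (- z) * (cexp (- h) - 1 + h) = h * fderiv z.
  by rewrite E addrK.
rewrite modulusN Eh !modulusM modulus_cexp ReN -/m in t.
have q := modulus_ge0 h; have := ler_wpM2l q (ltW h2).
have := ler_wpM2l (ltW p) b; nra.
Qed.

(** * The petal *)

(** In the variable w = exp(-z) this is the disc |w - 1| < 1, tangent to the
    parabolic fixed point 0 of w exp(-w). *)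
Definition petal : set C := [set z | `|im z| < pi / 2 /\ 1 / 2 < reexp z].

(** On the closed petal exp(-x) <= 2 cos y <= 2, and |sin y| <= |y|, so that
    |y - exp(-x) sin y| <= |y|; and exp(exp(-x) cos y) >= 1 + exp(-x) cos y.
    The last inequality is the growth rate that makes orbits escape. *)
Lemma petal_step z : `|im z| < pi / 2 -> 1 / 2 <= reexp z ->
  [/\ `|im (f z)| <= `|im z|, 0 < cos (im z),
     cos (im z) <= cos (im (f z)) &
     expR (re z) + cos (im z) <= expR (re (f z))].
Proof.
move=> hy hA; set r := expR (- re z).
have c0 : 0 < cos (im z) by apply: cos_gt0_pihalf; rewrite -ltr_norml.
have r0 : 0 < r := expR_gt0 _.
have Er : expR (re z) * r = 1 := expRxMexpNx_1 _.
have r2 : r <= 2 * cos (im z).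
  have -> : r = (1 / 2) * r * 2 by lra.
  suff : 1 / 2 * r <= cos (im z) by lra.
  by have := ler_wpM2r (ltW r0) hA; rewrite /reexp [X in _ <= X]mulrAC Er; lra.
have y1 : `|im (f z)| <= `|im z|.
  rewrite Im_f -/r; have := cos_le1 (im z) => c1.
  have [y0|y0] := leP 0 (im z).
    have s0 : 0 <= sin (im z).
      by apply: sin_ge0_pi; move: hy; rewrite ger0_norm //; have := pi_gt0 R; lra.
    by have s1 := sin_le_id y0; rewrite (ger0_norm y0) ler_norml; apply/andP; split; nra.
  have s0 : 0 <= sin (- im z).
    by apply: sin_ge0_pi; move: hy; rewrite ltr0_norm //; have := pi_gt0 R; lra.
  have s1 : sin (- im z) <= - im z by apply: sin_le_id; lra.
  move: s0 s1; rewrite sinN => s0 s1.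
  by rewrite (ltr0_norm y0) ler_norml; apply/andP; split; nra.
split => //.
  rewrite -cos_norm -(cos_norm (im (f z))).
  have pp := pi_gt0 R.
  rewrite leNgt; apply/negP; rewrite ltr_cos ?in_itv /=; first by rewrite ltNge y1.
    by rewrite normr_ge0 /=; lra.
  by rewrite normr_ge0 /=; lra.
rewrite Re_f -/r expRD.
have := expR_ge1Dx (r * cos (im z)); have e0 := expR_gt0 (re z).
move=> h; have : expR (re z) * (1 + r * cos (im z)) <= expR (re z) * expR (r * cos (im z)) by rewrite ler_pM2l.
by rewrite mulrDr mulr1 mulrA Er mul1r.
Qed.

(** The closed petal is mapped into the open one; this strictness is what
    makes |f'| > 1 at points outside the petal whose image is outside too. *)
Lemma petal_f z : `|im z| < pi / 2 -> 1 / 2 <= reexp z -> petal (f z).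
Proof.
move=> hy hA; have [y1 c0 c1 e1] := petal_step hy hA; split.
  exact: le_lt_trans y1 hy.
have e0 := expR_gt0 (re z); move: hA; rewrite /reexp => hA; nra.
Qed.

Lemma petal_iter n z : petal z -> petal (iter n (@f R) z).
Proof. by move=> h; elim: n => //= n [h1 /ltW h2]; exact: petal_f. Qed.

Lemma petal_conj z : petal z -> petal z^*.
Proof. by case: z => a b []; rewrite /petal /reexp /= normrN cosN. Qed.

Lemma real_f_petal z : im z = 0 -> petal (f z).
Proof.
move=> h; rewrite /petal /reexp /= Im_f h sin0 mulr0 subr0 normr0 cos0.
split; first by rewrite divr_gt0 ?pi_gt0.
have := expR_gt0 (- re z); have := expR_ge1Dx (re (f z)).
rewrite Re_f h cos0; have := expR_ge1Dx (- re z); lra.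
Qed.

(** * The inverse branch with values in the upper half strip *)

(** The removed ray [1, +oo) is the image of the real axis; it starts at the
    critical value f(0) = 1. *)
Definition slit_strip : set C :=
  [set w | `|im w| <= pi /\ ~ (im w = 0 /\ 1 <= re w)].

Definition upper_strip : set C := [set z | 0 < im z <= pi].

Lemma preimage_on_top (u : R) : exists x : R, x - expR (- x) = u.
Proof.
have [|||x _ <-] := @IVT R (fun x => x - expR (- x)) u (`|u| + 1) u.
- by have := ler_norm u; lra.
- apply: continuous_subspaceT => x; apply: cvgB; first exact: cvg_id.
  apply: (@continuous_comp R R R (fun x => - x) expR); last exact: continuous_expR.
  exact: opp_continuous.
- have h1 : u - expR (- u) <= u by have := expR_ge0 (- u); lra.
  have h2 : u <= `|u| + 1 - expR (- (`|u| + 1)).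
    have : expR (- (`|u| + 1)) <= 1 by rewrite expR_le1; have := normr_ge0 u; lra.
    by have := ler_norm u; lra.
  by rewrite ge_min h1 /= le_max h2 orbT.
by exists x.
Qed.

(** Solving f(x + iy) = u + iv for x gives x = u - (y - v) cot y and leaves
    the equation [gap] y = 0 in y alone. *)
Section InverseBranch.
Variables u v : R.

Let gap (y : R) := (y - v) - sin y * expR (- u + (y - v) * (cos y / sin y)).

Lemma branch_gap_continuous (y : R) : sin y != 0 -> {for y, continuous gap}.
Proof.
move=> s0.
have c1 : {for y, continuous (fun y : R => y - v)}.
  by apply: cvgB; [exact: cvg_id|exact: cvg_cst].
have c2 : {for y, continuous (fun y : R => - u + (y - v) * (cos y / sin y))}.
  apply: (@continuousD R R R (fun=> - u)); first exact: cvg_cst.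
  apply: (@continuousM R R) => //; apply: (@continuousM R R).
    exact: continuous_cos.
  by apply: (@continuousV R R) => //; exact: continuous_sin.
apply: (@continuousB R R R) => //; apply: (@continuousM R R).
  exact: continuous_sin.
by apply: (@continuous_comp R R R _ expR); [exact: c2|exact: continuous_expR].
Qed.

Lemma preimage_of_root (y : R) : 0 < y < pi -> v < y -> gap y = 0 ->
  exists2 z, upper_strip z & f z = u +i* v.
Proof.
move=> /andP[y0 yp] vy /eqP; rewrite /gap subr_eq0 => /eqP h.
have s0 : 0 < sin y by apply: sin_gt0_pi; rewrite y0.
pose x := u - (y - v) * (cos y / sin y).
have E : y - v = sin y * expR (- x) by rewrite h /x opprB addrC.
exists (x +i* y); first by rewrite /upper_strip /= y0 ltW.
apply/eqP; rewrite eq_complex Re_f Im_f /=; apply/andP; split; apply/eqP.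
  rewrite {1}/x E; field; exact: lt0r_neq0.
by rewrite mulrC -E; lra.
Qed.

Lemma branch_gap_root (y1 y2 : R) : 0 < y1 -> v <= y1 -> y1 <= y2 -> y2 < pi ->
  gap y1 <= 0 -> 0 <= gap y2 -> exists2 y : R, y1 <= y <= y2 & gap y = 0.
Proof.
move=> y10 vy1 y12 y2p h1 h2.
have [|||y hy Hy] := @IVT R gap y1 y2 0 => //.
- apply: continuous_in_subspaceT => y; rewrite inE /= in_itv /= => hy.
  by apply: branch_gap_continuous; apply: lt0r_neq0; apply: sin_gt0_pi; lra.
- by rewrite ge_min h1 le_max h2 orbT.
by exists y => //; rewrite in_itv in hy.
Qed.

(** Near pi the cotangent tends to -oo, so that the exponential term is at
    most sin y exp(-u), and y = pi - d works once d is small enough. *)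
Lemma branch_gap_right_end : v < pi -> - pi <= v ->
  exists y2 : R, [/\ pi / 2 <= y2, v < y2, y2 < pi & 0 <= gap y2].
Proof.
move=> vp vN; have e0 := expR_gt0 (- u); have p0 := pi_gt0 R.
pose d := Num.min (pi / 2) ((pi - v) / (1 + expR (- u))).
have d0 : 0 < d by rewrite lt_min !divr_gt0 //; lra.
have d1 : d <= pi / 2 by rewrite ge_min lexx.
have d2 : d * (1 + expR (- u)) <= pi - v.
  by rewrite -ler_pdivlMr; [rewrite ge_min lexx orbT|lra].
have d3 : d < pi - v by nra.
exists (pi - d); split; [lra|lra|lra|].
rewrite /gap; set y := pi - d.
have sE : sin y = sin d by rewrite /y sinB sinpi cospi; ring.
have cE : cos y = - cos d by rewrite /y cosB sinpi cospi; ring.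
have s0 : 0 < sin d by apply: sin_gt0_pi; lra.
have s1 : sin d <= d by apply: sin_le_id; lra.
have c0 : 0 <= cos d by apply: cos_ge0_pihalf; lra.
have : expR (- u + (y - v) * (cos y / sin y)) <= expR (- u).
  rewrite ler_expR gerDl sE cE mulNr mulrN oppr_le0 mulr_ge0 ?divr_ge0 //; last exact: ltW.
  by rewrite /y; lra.
rewrite sE; set E := expR (_ + _) => hE; have E0 : 0 <= E by rewrite expR_ge0.
have : sin d * E <= d * expR (- u) by apply: ler_pM => //; exact: ltW.
by rewrite /y; nra.
Qed.

(** For v > 0 take y = v. For v < 0 the exponent is about -v/y, so the
    exponential beats 1/y as y tends to 0. For v = 0 the exponent tends to 1 -
    u, which is positive because the point is off the slit. *)
Lemma branch_gap_left_end : v < pi -> - pi <= v -> ~ (v = 0 /\ 1 <= u) ->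
  exists y1 : R, [/\ 0 < y1, v <= y1, (0 < v /\ y1 = v \/ y1 <= 1 /\ v < y1) & gap y1 <= 0].
Proof.
move=> vp vN vu; have p4 : pi < 4 :> R by have := pihalf_lt2 R; lra.
have [v0|v0|v0] := ltrgtP v 0; last first.
- have u1 : u < 1 by rewrite ltNge; apply/negP => ?; exact: vu.
  pose d := Num.min (1 / 2) ((1 - u) / 2).
  have d0 : 0 < d by rewrite lt_min; apply/andP; split; lra.
  have d1 : d <= 1 / 2 by rewrite ge_min lexx.
  have d2 : d <= (1 - u) / 2 by rewrite ge_min lexx orbT.
  exists d; split => //; first by lra.
    by right; split; lra.
  have s0 : 0 < sin d by apply: sin_gt0_pi; have := pi_ge2 R; lra.
  have [c /andP[c0 cd] sE] := sin_MVT d0.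
  have scd : d * cos d <= sin d.
    rewrite sE ler_pM2l //; rewrite leNgt; apply/negP; rewrite ltr_cos ?in_itv /=; try lra.
    + by have := pi_ge2 R; lra.
    + by have := pi_ge2 R; lra.
  have := one_minus_cos_le d; set t := d ^+ 2 / 2 => hc.
  have t0 : 0 <= t by rewrite /t divr_ge0 ?sqr_ge0.
  have t1 : t <= d / 4 by rewrite /t expr2; nra.
  have c0' : 0 < cos d by lra.
  have h1 : cos d <= d * (cos d / sin d).
    have s1 : sin d <= d by apply: sin_le_id; lra.
    by rewrite mulrA ler_pdivlMr // mulrC ler_pM2r.
  rewrite /gap v0 subr0.
  have : expR (- u + cos d) <= expR (- u + d * (cos d / sin d)) by rewrite ler_expR lerD2l.
  have := expR_ge1Dx (- u + cos d); set E0 := expR (- u + cos d).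
  set E := expR (- u + d * _) => hE0 hE.
  have : d * (cos d * E0) <= sin d * E.
    rewrite mulrA; apply: ler_pM => //; first by apply: mulr_ge0; lra.
    exact: expR_ge0.
  have : 1 <= cos d * E0 by nra.
  by nra.
- exists v; split => //; first by left.
  rewrite /gap subrr mul0r addr0 sub0r oppr_le0 mulr_ge0 ?expR_ge0 //.
  by apply: sin_ge0_pi; lra.
- pose V := - v; have V0 : 0 < V by rewrite /V; lra.
  have nu := normr_ge0 u; have nu' := ler_norm u; have nu2 := ler_norm (- u); rewrite normrN in nu2.
  (* Chosen so that the exponent is at least V / (4 d), whence the
     exponential term is at least (d / 2) V^2 / (32 d^2) >= 5 > d + V. *)
  pose d := Num.min (1 / 2) (Num.min (V / (4 * (`|u| + 1))) (V ^+ 2 * (1 / 320))).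
  have V2 : 0 < V ^+ 2 by rewrite exprn_gt0.
  have q : 0 < 4 * (`|u| + 1) by lra.
  have d0 : 0 < d.
    rewrite !lt_min (divr_gt0 V0 q) /=; apply/andP; split; lra.
  have d1 : d <= 1 / 2 by rewrite ge_min lexx.
  have d2 : d * (4 * (`|u| + 1)) <= V by rewrite -ler_pdivlMr // !ge_min lexx orbT.
  have d3 : d * 320 <= V ^+ 2.
    suff : d <= V ^+ 2 * (1 / 320) by lra.
    by rewrite !ge_min lexx !orbT.
  clearbody d.
  exists d; split => //; [by lra|by right; split; lra|].
  have hc := one_minus_cos_le d.
  have c1 : 1 / 2 <= cos d by nra.
  have s0 : 0 < sin d by apply: sin_gt0_pi; have := pi_ge2 R; lra.
  have s1 : sin d <= d by apply: sin_le_id; lra.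
  have s2 : d / 2 <= sin d.
    have [c /andP[c0 cd] ->] := sin_MVT d0.
    have := one_minus_cos_le c; nra.
  have cot : 1 / (2 * d) <= cos d / sin d.
    by rewrite ler_pdivlMr // mulrC mulrA ler_pdivrMr; nra.
  have hT : V / (4 * d) <= - u + (d - v) * (cos d / sin d).
    have i0 : 0 < d^-1 by rewrite invr_gt0.
    have : V * (1 / (2 * d)) <= (d - v) * (cos d / sin d).
      by apply: ler_pM => //; rewrite ?divr_ge0 /V; lra.
    have -> : V * (1 / (2 * d)) = V / (4 * d) + V / (4 * d).
      by field; exact: lt0r_neq0.
    suff : u <= V / (4 * d) by lra.
    by rewrite ler_pdivlMr; nra.
  have T0 : 0 <= V / (4 * d) by rewrite divr_ge0; lra.
  have := @expR_ge1Dxn R (V / (4 * d)) 1 T0.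
  have := hT; rewrite -ler_expR /gap; set E1 := expR (V / _); set E := expR (_ + _).
  rewrite (_ : 2`!%:R = 2) //.
  move=> hE hE1; have : V ^+ 2 / (32 * d ^+ 2) <= E.
    apply: le_trans hE; apply: le_trans hE1.
    have -> : (V / (4 * d)) ^+ 2 / 2 = V ^+ 2 / (32 * d ^+ 2).
      by field; exact: lt0r_neq0.
    by rewrite lerDr.
  have d20 : 0 < d ^+ 2 by rewrite exprn_gt0.
  rewrite ler_pdivrMr; last by lra.
  move=> k1; have E0 : 0 < E := expR_gt0 _.
  have k2 : d * 320 <= E * (32 * d ^+ 2) by lra.
  have k3 : 10 <= E * d by rewrite expr2 in k2; nra.
  have : d / 2 * E <= sin d * E by rewrite ler_pM2r.
  by rewrite /V in V0; nra.
Qed.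

End InverseBranch.

Lemma upper_preimage_exists w : slit_strip w -> exists2 z, upper_strip z & f z = w.
Proof.
case: w => u v [/= hv vu]; move: hv; rewrite ler_norml => /andP[vN vp].
move: vp; rewrite le_eqVlt => /predU1P[->|vp].
  have [x hx] := preimage_on_top u.
  exists (x +i* pi); first by rewrite /upper_strip /= pi_gt0 lexx.
  apply/eqP; rewrite eq_complex Re_f Im_f /= cospi sinpi mulr0 subr0 eqxx andbT.
  by rewrite mulrN1 hx.
have [y2 [a1 a2 a3 a4]] := branch_gap_right_end u vp vN.
have [y1 [b1 b2 b3 b4]] := branch_gap_left_end vp vN vu.
have y12 : y1 <= y2.
  by case: b3 => [[v0 ->]|[h _]]; [exact: ltW|have := pihalf_ge1 R; lra].
have [y /andP[h1 h2] Hy] := branch_gap_root b1 b2 y12 a3 b4 a4.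
apply: (preimage_of_root _ _ Hy); first by lra.
case: b3 => [[v0 y1v]|[_ h]]; last by lra.
rewrite lt_neqAle -{2}y1v h1 andbT; apply/eqP => vy; move/eqP: Hy.
rewrite -vy subrr mul0r addr0 sub0r oppr_eq0 mulf_eq0 (gt_eqF (expR_gt0 _)) orbF.
by rewrite gt_eqF // sin_gt0_pi // v0.
Qed.

(** For f z = u + iv, the relation exp(-x) sin y = y - v gives -x = ln (y - v)
    - ln (sin y), and eliminating x with x = u - (y - v) cot y leaves the
    value -u. *)
Definition log_arg_gap (v y : R) : R := ln (y - v) - ln (sin y) - (y - v) * (cos y / sin y).

(** With t = y - v, the derivative is (sin^2 y - 2 t sin y cos y + t^2) / (t
    sin^2 y), and the numerator is (t - sin y cos y)^2 + sin^4 y. *)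
Lemma log_arg_gap_increasing (v y1 y2 : R) : 0 < y1 -> v < y1 -> y1 < y2 -> y2 < pi ->
  log_arg_gap v y1 < log_arg_gap v y2.
Proof.
move=> y10 vy1 y12 y2p; set Q := log_arg_gap v.
pose dQ y := (y - v)^-1 - (sin y)^-1 * cos y -
  ((y - v) * (- (sin y) ^- 2) + cos y / sin y).
have D y : 0 < y < pi -> v < y -> is_derive y 1 Q (dQ y).
  move=> hy vy; have s0 : 0 < sin y by exact: sin_gt0_pi.
  have sn := lt0r_neq0 s0; have y0 : 0 < y - v by lra.
  have d1 : is_derive y 1 (fun y : R => y - v) 1.
    by apply: is_derive_eq; rewrite oppr0 addr0.
  have d2 : is_derive y 1 (fun y : R => ln (y - v)) (y - v)^-1.
    have := @is_derive1_comp R (@ln R) (fun y => y - v) y _ _ (is_derive1_ln y0) d1.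
    by rewrite mulr1.
  have d3 : is_derive y 1 (fun y : R => ln (sin y)) ((sin y)^-1 * cos y).
    exact: is_derive1_comp (is_derive1_ln s0) (is_derive_sin y).
  have d4 := is_deriveV sn (is_derive_sin y).
  have d5 : is_derive y 1 (fun y => cos y / sin y) (- (sin y) ^- 2).
    apply: is_derive_eq; rewrite /GRing.scale /=.
    transitivity (- (cos y ^+ 2 + sin y ^+ 2) * sin y ^- 2); last first.
      by rewrite cos2Dsin2 mulN1r.
    by field.
  have d6 : is_derive y 1 (fun y => (y - v) * (cos y / sin y))
      ((y - v) * (- (sin y) ^- 2) + cos y / sin y).
    by apply: is_derive_eq; rewrite /GRing.scale /= mulr1.
  by apply: is_derive_eq.
have in_ y : y1 <= y <= y2 -> 0 < y < pi /\ v < y by move=> /andP[? ?]; split; lra.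
rewrite -subr_gt0; have [||c cin ->] := @MVT R Q dQ y1 y2 y12.
- by move=> y; rewrite in_itv /= => /andP[? ?]; apply: D; lra.
- apply: continuous_in_subspaceT => y; rewrite inE /= in_itv /= => /in_[h1 h2].
  have [h _] := D y h1 h2.
  by apply: differentiable_continuous; exact/derivable1_diffP.
rewrite in_itv /= in cin; have [h1 h2] : 0 < c < pi /\ v < c by apply: in_; lra.
rewrite mulr_gt0 ?(subr_gt0 y1) //; have s0 : 0 < sin c by exact: sin_gt0_pi.
have t0 : 0 < c - v by lra.
have -> : dQ c =
    (sin c ^+ 2 - 2 * (c - v) * sin c * cos c + (c - v) ^+ 2) / ((c - v) * sin c ^+ 2).
  by rewrite /dQ; field; rewrite !lt0r_neq0.
rewrite divr_gt0 ?mulr_gt0 ?exprn_gt0 //.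
have -> : sin c ^+ 2 - 2 * (c - v) * sin c * cos c + (c - v) ^+ 2 =
  ((c - v) - sin c * cos c) ^+ 2 + sin c ^+ 2 * (1 - cos c ^+ 2) by ring.
rewrite -sin2cos2 ltr_wpDl ?sqr_ge0 // mulr_gt0 ?exprn_gt0 //.
Qed.

Lemma log_arg_gap_f z : 0 < im z < pi ->
  im (f z) < im z /\ log_arg_gap (im (f z)) (im z) = - re (f z).
Proof.
move=> h; have s0 : 0 < sin (im z) by exact: sin_gt0_pi.
have e0 := expR_gt0 (- re z).
have E : im z - im (f z) = expR (- re z) * sin (im z) by rewrite Im_f; ring.
have lt : 0 < im z - im (f z) by rewrite E mulr_gt0.
split; first by rewrite -subr_gt0.
rewrite /log_arg_gap E lnM ?posrE // expRK Re_f.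
by field; exact: lt0r_neq0.
Qed.

Lemma f_top z : im z = pi -> re (f z) = re z - expR (- re z) /\ im (f z) = pi.
Proof. by move=> h; rewrite Re_f Im_f h cospi sinpi mulr0 subr0 mulrN1. Qed.

(** On the line Im z = pi the map is x - exp(-x), which is increasing; below
    it, y is determined by the monotonicity of [log_arg_gap], and then x by
    exp(-x). *)
Lemma f_injective_upper z1 z2 : upper_strip z1 -> upper_strip z2 -> f z1 = f z2 ->
  - pi <= im (f z1) -> im (f z1) <= pi -> z1 = z2.
Proof.
wlog y12 : z1 z2 / im z1 <= im z2 => [H|].
  have [le|/ltW le] := leP (im z1) (im z2); first exact: H.
  by move=> a b c d e; apply/esym; apply: H => //; rewrite -c.
move=> /andP[y1 p1] /andP[y2 p2] E vN vp.
have [t1|l1] := eqVneq (im z1) pi.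
  have t2 : im z2 = pi by apply/le_anti; rewrite p2 -t1.
  have [r1 _] := f_top t1; have [r2 _] := f_top t2.
  apply/eqP; rewrite eq_complex t1 t2 eqxx andbT.
  move: r2; rewrite -E r1; have [lt|lt|->//] := ltgtP (re z1) (re z2).
    by have := lt; rewrite -ltrN2 -ltr_expR; lra.
  by have := lt; rewrite -ltrN2 -ltr_expR; lra.
have lt1 : im z1 < pi by rewrite lt_neqAle l1.
have lt2 : im z2 < pi.
  rewrite lt_neqAle p2 andbT; apply/eqP => /f_top[_].
  rewrite -E Im_f => h; have : 0 < sin (im z1) by apply: sin_gt0_pi; rewrite y1.
  by have := expR_gt0 (- re z1); nra.
have [v1 q1] : im (f z1) < im z1 /\ log_arg_gap (im (f z1)) (im z1) = - re (f z1).
  by apply: log_arg_gap_f; rewrite y1.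
have [v2 q2] : im (f z2) < im z2 /\ log_arg_gap (im (f z2)) (im z2) = - re (f z2).
  by apply: log_arg_gap_f; rewrite y2.
have ey : im z1 = im z2.
  move: y12; rewrite le_eqVlt => /predU1P[//|lt].
  by rewrite -E in q2; have := log_arg_gap_increasing y1 v1 lt lt2; rewrite q1 q2 ltxx.
apply/eqP; rewrite eq_complex ey eqxx andbT -eqr_opp; apply/eqP/expR_inj.
have s0 : 0 < sin (im z2) by apply: sin_gt0_pi; rewrite y2.
apply: (mulIf (lt0r_neq0 s0)); have := congr1 im E; rewrite !Im_f ey; lra.
Qed.

Definition branch w : C := xget 0 [set z | upper_strip z /\ f z = w].

Lemma branchP w : slit_strip w -> upper_strip (branch w) /\ f (branch w) = w.
Proof.
move=> /upper_preimage_exists[z h1 h2]; rewrite /branch.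
by case: xgetP => [x _ //|/(_ z)]; case.
Qed.

Lemma branch_unique z : upper_strip z -> `|im (f z)| <= pi -> branch (f z) = z.
Proof.
move=> hz; rewrite ler_norml => /andP[h1 h2]; rewrite /branch.
case: xgetP => [x _ [hx e]|/(_ z)]; last by case.
by apply: f_injective_upper => //; rewrite e.
Qed.

(** If x is very negative then |exp(-z)| = |f z - z| is at most linear in |x|,
    which is impossible. *)
Lemma f_proper_bound z w : 0 <= im z <= pi -> modulus (f z - w) < 1 ->
  `|re z| <= modulus w + 5.
Proof.
move=> /andP[y0 yp] h; have p4 : pi < 4 :> R by have := pihalf_lt2 R; lra.
have m0 := modulus_ge0 w.
have hf : modulus (f z) < modulus w + 1.
  by have := modulusD (f z - w) w; rewrite subrK; lra.
have := le_lt_trans (abs_Re_le _) hf; have := le_lt_trans (abs_Im_le _) hf.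
rewrite Re_f Im_f !ltr_norml => /andP[i1 i2] /andP[r1 r2].
have c1 := cos_le1 (im z); have c2 := cos_geN1 (im z).
have e0 := expR_gt0 (- re z).
have [x0|x0] := leP 0 (re z).
  have e1 : expR (- re z) <= 1 by rewrite expR_le1 oppr_le0.
  by rewrite ger0_norm //; nra.
rewrite ltr0_norm //; have x1 : 0 <= - re z by lra.
have := @expR_ge1Dxn R (- re z) 1 x1; rewrite (_ : 2`!%:R = 2) //.
have := cos2Dsin2 (im z).
have s0 : 0 <= sin (im z) by apply: sin_ge0_pi; rewrite y0.
move: i1 i2 r1 r2; set E := expR (- re z) in e0 *.
set c := cos _ in c1 c2 *; set s := sin _ in s0 *; set x := re z in x0 x1 *.
move=> i1 i2 r1 r2 cs hE.
have cs1 : 1 <= `|c| + s.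
  have : `|c| ^+ 2 = c ^+ 2 by rewrite real_normK ?num_real.
  have : `|c| <= 1 by rewrite ler_norml c1 c2.
  have := normr_ge0 c; nra.
have : E <= E * `|c| + E * s by nra.
have : E * `|c| <= modulus w + 1 - x.
  by rewrite -[E]gtr0_norm // -normrM ler_norml; apply/andP; split; lra.
move=> k1 k2; have k3 : E <= 2 * modulus w + 6 - x by lra.
have : (- x - 1) ^+ 2 <= (modulus w + 4) ^+ 2.
  have := sqr_ge0 (modulus w); move: hE k3 m0; clear.
  by move: (modulus w) => m; rewrite !expr2 => *; lra.
have [le|lt] := leP (- x) 1; first by lra.
by rewrite ler_sqr ?nnegrE; lra.
Qed.

Lemma real_f_ge1 z : im z = 0 -> im (f z) = 0 /\ 1 <= re (f z).
Proof.
move=> h; rewrite Im_f Re_f h sin0 cos0 mulr0 mulr1 subr0; split => //.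
by have := expR_ge1Dx (- re z); lra.
Qed.

(** By properness the preimages of points near w0 stay in a rectangle. There f
    z - w0 vanishes only at the preimage of w0, so by compactness |f z - w0|
    is bounded below away from that preimage. *)
Lemma branch_continuous w0 e : slit_strip w0 -> 0 < e -> exists2 d : R, 0 < d &
  forall w, slit_strip w -> modulus (w - w0) < d -> modulus (branch w - branch w0) < e.
Proof.
move=> Dw0 e0; have [/andP[z1 z2] fz0] := branchP Dw0; set z0 := branch w0 in z1 z2 fz0 *.
have m0 := modulus_ge0 w0.
pose g1 z := modulus (f z - w0); pose g2 z := e - modulus (z - z0).
have c1 : continuous g1.
  move=> z; apply: (@continuous_comp C C R (@f R) (fun z => modulus (z - w0))).
    exact: continuous_f.
  exact: continuous_distance.
have c2 : continuous g2.
  move=> z; apply: (@continuousB R R C (fun=> e) (fun z => modulus (z - z0))).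
    exact: cst_continuous.
  exact: continuous_distance.
pose K := rect (- (modulus w0 + 5)) (modulus w0 + 5) 0 pi.
have cK : compact K by exact: rect_compact.
have [|m mp hm] := compact_pos_min2 cK c1 c2.
  move=> z [hx /andP[y0 yp]]; have := modulus_ge0 (f z - w0); rewrite le_eqVlt.
  case/predU1P => [/esym/modulus_eq0/eqP|]; last by left.
  rewrite subr_eq0 => /eqP fz; right; rewrite /g2.
  suff -> : z = z0 by rewrite subrr modulus0 subr0.
  move: y0; rewrite le_eqVlt => /predU1P[/esym/real_f_ge1|y0].
    by rewrite fz => h; case: Dw0.
  apply: f_injective_upper; rewrite ?fz ?fz0 //; try by rewrite /upper_strip /= ?y0 ?z1.
    by case: Dw0; rewrite ler_norml => /andP[].
  by case: Dw0; rewrite ler_norml => /andP[].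
exists (Num.min 1 m); first by rewrite lt_min ltr01.
move=> w Dw; rewrite lt_min => /andP[lt1 ltm]; have [/andP[y0 yp] fw] := branchP Dw.
have Kw : K (branch w).
  split; last by rewrite ltW.
  by rewrite -ler_norml; apply: (@f_proper_bound _ w0); rewrite ?fw // ltW.
have [|] := hm _ Kw; rewrite /g1 /g2 ?fw; lra.
Qed.

(** * The folded map and its inverse branches *)

Definition fold w : C := if 0 <= im w then w else w^*.

(** The upper half of the strip minus the petal. The side Im z = pi belongs to
    it, the real axis does not. *)
Definition half_julia : set C := [set z | upper_strip z /\ reexp z <= 1 / 2].

(** f commutes with conjugation, so it acts on the quotient of the plane by
    conjugation, represented by the upper half plane. *)
Definition folded_f z : C := fold (f z).

(** The two inverse branches of [folded_f]: under f the value goes to w or to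
    its conjugate. *)
Definition hbranch (b : bool) w : C := branch (if b then w^* else w).

Lemma Re_fold w : re (fold w) = re w.
Proof. by rewrite /fold; case: ifP; rewrite ?Re_conj. Qed.

Lemma Im_fold w : im (fold w) = `|im w|.
Proof.
rewrite /fold; case: ifPn => [h|]; first by rewrite ger0_norm.
by rewrite -ltNge Im_conj => /ltr0_norm->.
Qed.

Lemma reexp_conj w : reexp (w^*) = reexp w.
Proof. by rewrite /reexp Re_conj Im_conj cosN. Qed.

Lemma reexp_fold w : reexp (fold w) = reexp w.
Proof. by rewrite /fold; case: ifP => // _; rewrite reexp_conj. Qed.

Lemma half_julia_slit w : half_julia w -> slit_strip w /\ slit_strip w^*.
Proof.
move=> [/andP[h1 h2] _]; rewrite /slit_strip /= Im_conj normrN Re_conj gtr0_norm //.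
by split; split => // -[h _]; lra.
Qed.

Lemma upper_petal z : upper_strip z -> 1 / 2 <= reexp z -> `|im z| < pi / 2.
Proof.
move=> /andP[y0 yp]; rewrite gtr0_norm // => hA; rewrite ltNge; apply/negP => h.
have : cos (im z) <= cos (pi / 2).
  rewrite leNgt; apply/negP; rewrite ltr_cos ?in_itv /=; try by have := pi_gt0 R; lra.
rewrite cos_pihalf => c0; have e0 := expR_gt0 (re z).
by move: hA; rewrite /reexp; nra.
Qed.

Lemma half_julia_fold_petal w : half_julia (fold w) -> ~ petal w.
Proof. by move=> [_]; rewrite reexp_fold => h [_]; rewrite ltNge h. Qed.

Lemma hbranch_slit b w : half_julia w -> slit_strip (if b then w^* else w).
Proof. by move=> /half_julia_slit[h1 h2]; case: b. Qed.

Lemma f_hbranch b w : half_julia w -> f (hbranch b w) = if b then w^* else w.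
Proof. by move=> /(hbranch_slit b)/branchP[]. Qed.

Lemma folded_f_hbranch b w : half_julia w -> folded_f (hbranch b w) = w.
Proof.
move=> h; rewrite /folded_f f_hbranch // /fold; case: h => /andP[h _] _.
by case: b; rewrite ?Im_conj ?oppr_ge0 ?(ltW h) // leNgt h /= conjcK.
Qed.

(** If the preimage were in the petal, so would be its image, by invariance. *)
Lemma hbranch_half_julia b w : half_julia w -> half_julia (hbranch b w).
Proof.
move=> h; have [hz fz] := branchP (hbranch_slit b h); split => //.
rewrite leNgt; apply/negP => /ltW hA.
have := petal_f (upper_petal hz hA) hA; rewrite fz => hp.
apply: (@half_julia_fold_petal (if b then w^* else w)) => //.
have := folded_f_hbranch b h; rewrite /folded_f f_hbranch // => -> //.
Qed.

Lemma hbranch_folded_f z : half_julia z -> half_julia (folded_f z) ->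
  z = hbranch (im (f z) < 0) (folded_f z).
Proof.
move=> [hz _] [/andP[_ h] _]; rewrite /folded_f Im_fold in h.
by rewrite -{1}(branch_unique hz h) /hbranch /folded_f /fold leNgt; case: ltP => //= _; rewrite conjcK.
Qed.

Lemma modulus_conjB z w : modulus (z^* - w^*) = modulus (z - w).
Proof. by rewrite -rmorphB modulus_conj. Qed.

Lemma hbranch_continuous b w0 e : half_julia w0 -> 0 < e -> exists2 d : R, 0 < d &
  forall w, half_julia w -> modulus (w - w0) < d ->
    modulus (hbranch b w - hbranch b w0) < e.
Proof.
move=> h0 e0; have [d d0 hd] := branch_continuous (hbranch_slit b h0) e0.
exists d => // w hw lt; apply: hd; first exact: hbranch_slit.
by case: b => //; rewrite modulus_conjB.
Qed.

Lemma fderiv_gt1 z : half_julia z -> half_julia (folded_f z) -> 1 < modulus (fderiv z).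
Proof.
move=> [hz hA] hF; have lt : reexp z < 1 / 2.
  rewrite lt_neqAle hA andbT; apply/eqP => e.
  apply: (half_julia_fold_petal hF); apply: petal_f; last by rewrite e.
  by apply: upper_petal => //; rewrite e.
have e0 := expR_gt0 (- re z).
have : 1 ^+ 2 < modulus (fderiv z) ^+ 2.
  by rewrite modulus_fderiv_sqr expr1n ltrDl mulr_gt0 ?exprn_gt0 //; lra.
by rewrite ltr_sqr ?nnegrE ?modulus_ge0.
Qed.

(** To the left of -2 the factor exp(-x) is large. On the remaining rectangle,
    at each point either [reexp] z < 1/2 or f z is in the open petal;
    compactness makes this alternative uniform. *)
Lemma fderiv_uniform (M : R) : exists2 k : R, 1 < k & forall z,
  half_julia z -> half_julia (folded_f z) -> re z <= M -> k <= modulus (fderiv z).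
Proof.
pose g1 z := 1 / 2 - reexp z; pose g2 z := reexp (f z) - 1 / 2.
have c1 : continuous g1.
  move=> z; apply: (@continuousB R R C (fun=> 1 / 2) reexp); first exact: cst_continuous.
  exact: continuous_reexp.
have c2 : continuous g2.
  move=> z; apply: (@continuousB R R C (fun z => reexp (f z)) (fun=> 1 / 2)); last exact: cst_continuous.
  apply: (@continuous_comp C C R (@f R) reexp); first exact: continuous_f.
  exact: continuous_reexp.
have cK : compact (rect (- 2) M 0 pi) by exact: rect_compact.
have [|m m0 hm] := compact_pos_min2 cK c1 c2.
  move=> z [_ /andP[y0 yp]]; rewrite /g1 /g2.
  have [lt|le] := ltP (reexp z) (1 / 2); [left|right]; first lra.
  suff [_ ?] : petal (f z) by lra.
  move: y0; rewrite le_eqVlt => /predU1P[/esym/real_f_petal//|y0].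
  by apply: petal_f => //; apply: upper_petal => //; rewrite /upper_strip /= y0.
pose q := Num.min (1 / 3) (2 * m * expR (- M) ^+ 2).
have q0 : 0 < q by rewrite lt_min !mulr_gt0 ?exprn_gt0 ?expR_gt0 // andbT; lra.
have q1 : q <= 1 / 3 by rewrite ge_min lexx.
have q2 : q <= 2 * m * expR (- M) ^+ 2 by rewrite ge_min lexx orbT.
exists (Num.sqrt (1 + q)).
  by rewrite -[ltLHS]sqrtr1 ltr_sqrt; lra.
move=> z hz hF hM; rewrite -[leRHS]ger0_norm ?modulus_ge0 // -sqrtr_sqr ler_wsqrtr //.
rewrite modulus_fderiv_sqr lerD2l; have e0 := expR_gt0 (- re z).
have [lt|le] := ltP (re z) (- 2).
  apply: le_trans q1 _; have e1 : 1 <= expR (- re z).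
    by have := expR_ge1Dx (- re z); lra.
  have : reexp z <= 1 / 3.
    have : expR (re z) * expR (- re z) = 1 by rewrite expRxMexpNx_1.
    have : 3 <= expR (- re z) by have := expR_ge1Dx (- re z); lra.
    have := expR_gt0 (re z); have := cos_le1 (im z); rewrite /reexp; nra.
  have : 1 <= expR (- re z) ^+ 2 by rewrite expr_ge1.
  by nra.
apply: le_trans q2 _.
have : expR (- M) ^+ 2 <= expR (- re z) ^+ 2.
  by rewrite ler_sqr ?nnegrE ?expR_ge0 // ler_expR lerN2.
have := exprn_gt0 2 (expR_gt0 (- M)).
have [[/andP[y0 yp] _] [_ hA]] := (hz, hF).
have Kz : rect (- 2) M 0 pi z by split; [rewrite le hM|rewrite ltW].
rewrite /folded_f reexp_fold in hA.
have [] := hm z Kz; rewrite /g1 /g2; last by lra.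
by nra.
Qed.

(** * Lipschitz bounds along paths *)

(** A pointwise condition relative to [half_julia]: it makes sense on the side
    Im z = pi of this set, where the branches have no two-sided derivative. *)
Definition loc_lip (g : C -> C) (l : R) w := exists2 d : R, 0 < d &
  forall w', half_julia w' -> modulus (w' - w) < d ->
    modulus (g w' - g w) <= l * modulus (w' - w).

Lemma loc_lip_comp g h l m w : (forall x, half_julia x -> half_julia (g x)) ->
  0 <= l -> 0 <= m -> loc_lip g l w -> loc_lip h m (g w) -> loc_lip (h \o g) (m * l) w.
Proof.
move=> gX l0 m0 [d d0 hd] [e e0 he].
have l1 : 0 < l + 1 by lra.
exists (Num.min d (e / (l + 1))); first by rewrite lt_min d0 divr_gt0.
move=> w' Xw'; rewrite lt_min (ltr_pdivlMr _ e) // => /andP[lt1 lt2].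
have h1 := hd _ Xw' lt1; have p := modulus_ge0 (w' - w).
apply: le_trans (he _ (gX _ Xw') _) _ => /=; first by nra.
by rewrite -mulrA ler_wpM2l.
Qed.

(** Continuity of the branch brings its values into the range where
    [f_local_expansion] applies. *)
Lemma hbranch_loc_lip b w (k : R) : half_julia w -> 0 < k ->
  k < modulus (fderiv (hbranch b w)) -> loc_lip (hbranch b) k^-1 w.
Proof.
move=> Xw k0 hk; have [d d0 hd] := f_local_expansion hk.
have [e e0 he] := hbranch_continuous b Xw d0; exists e => // w' Xw' lt.
have := hd _ (he _ Xw' lt); rewrite !f_hbranch //.
have -> : modulus ((if b then w'^* else w') - (if b then w^* else w)) = modulus (w' - w).
  by case: b {hk hd he} => //; rewrite modulus_conjB.
by rewrite ler_pdivlMl.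
Qed.

Lemma hbranch_loc_lip1 b w : half_julia w -> loc_lip (hbranch b) 1 w.
Proof.
move=> Xw; rewrite -[X in loc_lip _ X]invr1; apply: hbranch_loc_lip => //.
apply: fderiv_gt1; first exact: hbranch_half_julia.
by rewrite folded_f_hbranch.
Qed.

(** The supremum of the times up to which the bound holds is such a time, and
    the local bound there moves it further unless it is the end. *)
Lemma curve_lipschitz (h : R -> C) (s t L : R) : s <= t -> 0 <= L ->
  (forall r, s <= r <= t -> exists2 d : R, 0 < d & forall r', s <= r' <= t ->
     `|r' - r| < d -> modulus (h r' - h r) <= L * `|r' - r|) ->
  modulus (h t - h s) <= L * (t - s).
Proof.
move=> st L0 hloc; pose T : set R := [set r | s <= r <= t /\ modulus (h r - h s) <= L * (r - s)].
have Ts : T s by split; rewrite ?lexx // !subrr mulr0 modulus0.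
have supT : has_sup T by split; [exists s|exists t => r [/andP[]]].
have sc : s <= sup T by exact: sup_upper_bound.
have ct : sup T <= t by apply: ge_sup; [exists s|move=> r [/andP[]]].
have [d d0 hd] : exists2 d : R, 0 < d & forall r', s <= r' <= t ->
     `|r' - sup T| < d -> modulus (h r' - h (sup T)) <= L * `|r' - sup T|.
  by apply: hloc; rewrite sc.
have Tc : modulus (h (sup T) - h s) <= L * (sup T - s).
  have [r Tr rc] := sup_adherent d0 supT; have [hr1 hr2] := Tr.
  have rle : r <= sup T by exact: sup_upper_bound.
  have := hd r hr1; rewrite ler0_norm ?subr_le0 // opprB => /(_ _)h1.
  have := modulusD (h (sup T) - h r) (h r - h s); rewrite addrA subrK modulusB.
  have : sup T - r < d by lra.
  by move=> /h1; lra.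
move: ct; rewrite le_eqVlt => /predU1P[<-//|ct].
pose r := Num.min t (sup T + d / 2).
have r1 : r <= t by rewrite ge_min lexx.
have r2 : r <= sup T + d / 2 by rewrite ge_min lexx orbT.
have r3 : sup T < r by rewrite lt_min ct; lra.
suff : r <= sup T by lra.
apply: sup_upper_bound => //; split; first by apply/andP; split; lra.
have := hd r; rewrite gtr0_norm ?subr_gt0 // => h1.
have := modulusD (h r - h (sup T)) (h (sup T) - h s); rewrite addrA subrK.
have : modulus (h r - h (sup T)) <= L * (r - sup T) by apply: h1; lra.
lra.
Qed.

Definition between (a b x : R) := Num.min a b <= x <= Num.max a b.

Lemma half_julia_left (x y x' : R) : half_julia (x +i* y) -> x' <= x -> half_julia (x' +i* y).
Proof.
move=> [hy]; rewrite /reexp /= => hA le; split => //; rewrite /reexp /=.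
have e1 : expR x' <= expR x by rewrite ler_expR.
have e0 := expR_gt0 x'; have [c|c] := leP 0 (cos y); nra.
Qed.

Lemma half_julia_vertical (x y1 y2 y : R) : half_julia (x +i* y1) -> y1 <= y -> y <= pi ->
  half_julia (x +i* y).
Proof.
move=> [/andP[/= h1 h2]]; rewrite /reexp /= => hA le lp; split.
  by rewrite /upper_strip /= lp andbT; lra.
rewrite /reexp /=; apply: le_trans hA; rewrite ler_pM2l ?expR_gt0 // leNgt.
by apply/negP; rewrite ltr_cos ?in_itv /=; lra.
Qed.

(** The set [half_julia] is closed under moving left and its vertical slices
    are intervals. So two of its points are joined in it by moving the right
    one horizontally to the abscissa of the left one, then vertically. *)
Lemma path_lipschitz (g : C -> C) (L : R) a b : half_julia a -> half_julia b -> 0 <= L ->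
  (forall w, half_julia w -> between (re a) (re b) (re w) ->
     between (im a) (im b) (im w) -> loc_lip g L w) ->
  modulus (g b - g a) <= L * (`|re b - re a| + `|im b - im a|).
Proof.
wlog : a b / re a <= re b => [H Xa Xb L0 hg|].
  have [le|/ltW le] := leP (re a) (re b); first exact: H.
  rewrite modulusB (distrC (re b)) (distrC (im b)); apply: H => // w Xw h1 h2.
  by apply: hg => //; rewrite /between minC maxC.
case: a b => [x1 y1] [x2 y2] /= x12 Xa Xb L0 hg.
(* The corner of the path from b to a. *)
have Xc : half_julia (x1 +i* y2) by exact: half_julia_left x12.
have B : between x1 x2 x1 /\ between y1 y2 y2.
  by rewrite /between !ge_min !le_max !lexx !orbT.
have modR (r r' y : R) : modulus ((r +i* y) - (r' +i* y)) = `|r - r'|.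
  by rewrite modulusE /= subrr expr0n addr0 sqrtr_sqr.
have modI (r r' x : R) : modulus ((x +i* r) - (x +i* r')) = `|r - r'|.
  by rewrite modulusE /= subrr expr0n add0r sqrtr_sqr.
have hor : modulus (g (x2 +i* y2) - g (x1 +i* y2)) <= L * (x2 - x1).
  apply: (@curve_lipschitz (fun r => g (r +i* y2))) => // r /andP[r1 r2].
  have Xr : half_julia (r +i* y2) by exact: half_julia_left r2.
  have [||d d0 hd] := hg _ Xr => /=; first by rewrite /between ge_min le_max r1 r2 orbT.
    by case: B.
  exists d => // r' /andP[r1' r2'] lt; rewrite -(modR _ _ y2); apply: hd; last by rewrite modR.
  exact: half_julia_left r2'.
have ver : modulus (g (x1 +i* y2) - g (x1 +i* y1)) <= L * `|y2 - y1|.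
  have vert (p q : R) : p <= q -> half_julia (x1 +i* p) -> half_julia (x1 +i* q) ->
    (forall y, p <= y <= q -> between y1 y2 y) ->
    modulus (g (x1 +i* q) - g (x1 +i* p)) <= L * (q - p).
    move=> pq Xp [/andP[_ /= qp] _] bt.
    have Xr r : p <= r <= q -> half_julia (x1 +i* r).
      by move=> /andP[r1 r2]; apply: (half_julia_vertical _ Xp) => //; lra.
    apply: (@curve_lipschitz (fun r => g (x1 +i* r))) => // r hr.
    have [||d d0 hd] := hg _ (Xr r hr) => /=; [by case: B|exact: bt|].
    exists d => // r' hr' lt; rewrite -(modI _ _ x1); apply: hd; last by rewrite modI.
    exact: Xr.
  have [le|/ltW le] := leP y1 y2.
    rewrite ger0_norm ?subr_ge0 //; apply: vert => // y /andP[? ?].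
    by rewrite /between ge_min le_max; apply/andP; split; apply/orP; [left|right].
  rewrite modulusB distrC ger0_norm ?subr_ge0 //; apply: vert => // y /andP[? ?].
  by rewrite /between ge_min le_max; apply/andP; split; apply/orP; [right|left].
have := modulusD (g (x2 +i* y2) - g (x1 +i* y2)) (g (x1 +i* y2) - g (x1 +i* y1)).
rewrite addrA subrK ger0_norm ?subr_ge0 //; lra.
Qed.

(** * Orbits outside the basin and contraction along them *)

Definition julia_orbit z := forall n, half_julia (iter n folded_f z).

Lemma julia_orbit_iter n z : julia_orbit z -> julia_orbit (iter n folded_f z).
Proof. by move=> h k; rewrite -iterD. Qed.

Lemma archimedean (A c : R) : 0 < c -> exists n : nat, A < n%:R * c.
Proof.
move=> c0; exists (Num.bound `|A / c|); rewrite -ltr_pdivrMr //.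
by apply: le_lt_trans (ler_norm _) _; apply: archi_boundP; exact: normr_ge0.
Qed.

Lemma folded_f_right z : half_julia z -> 0 <= re z -> folded_f z = f z.
Proof.
move=> [/andP[y0 yp] _] x0; rewrite /folded_f /fold Im_f; case: ifPn => // /negP[].
have e1 : expR (- re z) <= 1 by rewrite expR_le1 oppr_le0.
have e0 := expR_gt0 (- re z).
have s1 : sin (im z) <= im z by apply: sin_le_id; exact: ltW.
have s0 : 0 <= sin (im z) by apply: sin_ge0_pi; rewrite ltW.
by nra.
Qed.

(** Suppose that x_n >= 0 for all n; then folding never acts. If some y_n <
    pi/2, then afterwards cos y_n is bounded below and exp x_n grows linearly,
    so the orbit enters the petal. Otherwise x_n decreases, and x_n + y_n
    decreases at each step by at least exp(-x_0), as sin y - cos y >= 1 on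
    [pi/2, pi]; but it is nonnegative. *)
Lemma julia_orbit_return z : julia_orbit z -> exists n, re (iter n folded_f z) < 0.
Proof.
move=> Jz; apply: contrapT => hn; pose zn n := iter n folded_f z.
have x0 n : 0 <= re (zn n) by rewrite leNgt; apply/negP => h; apply: hn; exists n.
have fS n : zn n.+1 = f (zn n) by rewrite -folded_f_right //; exact: Jz.
have yb n : 0 < im (zn n) <= pi by case: (Jz n).
have p0 := pi_gt0 R.
have [[n0 hn0]|hy] := pselect (exists n, im (zn n) < pi / 2).
  pose c := cos (im (zn n0)).
  have c0 : 0 < c by apply: cos_gt0_pihalf; have := yb n0; lra.
  have key n : im (zn (n + n0)) <= im (zn n0) /\ n%:R * c <= expR (re (zn (n + n0))).
    elim: n => [|n [IH1 IH2]]; first by rewrite mul0r expR_ge0.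
    have hb := yb (n + n0)%N; have -> : zn (n.+1 + n0)%N = f (zn (n + n0)%N) by exact: fS.
    have e1 : expR (- re (zn (n + n0))) <= 1 by rewrite expR_le1 oppr_le0.
    have e0 := expR_gt0 (- re (zn (n + n0))).
    have s0 : 0 <= sin (im (zn (n + n0))) by apply: sin_ge0_pi; lra.
    split; first by rewrite Im_f; nra.
    have cc : c <= cos (im (zn (n + n0))).
      by rewrite leNgt; apply/negP; rewrite ltr_cos ?in_itv /=; have := yb n0; lra.
    rewrite Re_f expRD; set r := expR (- _) in e1 e0 *.
    have := expR_ge1Dx (r * cos (im (zn (n + n0)))).
    have E : expR (re (zn (n + n0))) * r = 1 by rewrite expRxMexpNx_1.
    have p := expR_gt0 (re (zn (n + n0))).
    move=> h; have := ler_wpM2l (ltW p) h.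
    rewrite mulrDr mulr1 mulrA E mul1r => h'.
    by apply: le_trans h'; rewrite -natr1 mulrDl mul1r lerD.
  have [n hN] := archimedean (1 / 2 / c) c0.
  have [k1 k2] := key n; have [_] := Jz (n + n0)%N; rewrite /reexp -/(zn _).
  have cc : c <= cos (im (zn (n + n0))).
    by rewrite leNgt; apply/negP; rewrite ltr_cos ?in_itv /=; have := yb n0; have := yb (n + n0)%N; lra.
  have : 1 / 2 < expR (re (zn (n + n0))) * c by rewrite -ltr_pdivrMr //; lra.
  by have := expR_gt0 (re (zn (n + n0))); nra.
have yh n : pi / 2 <= im (zn n) by rewrite leNgt; apply/negP => h; apply: hy; exists n.
have cN n : cos (im (zn n)) <= 0.
  rewrite -(cos_pihalf R) leNgt; apply/negP; rewrite ltr_cos ?in_itv /=; have := yb n; have := yh n; lra.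
pose q := expR (- re z); have q0 : 0 < q := expR_gt0 _.
have key n : re (zn n) <= re z /\ re (zn n) + im (zn n) <= re z + im z - n%:R * q.
  elim: n => [|n [IH1 IH2]]; first by rewrite mul0r subr0.
  have s0 : 0 <= sin (im (zn n)) by apply: sin_ge0_pi; have := yb n; lra.
  have := cos2Dsin2 (im (zn n)); have := cN n; have := sin_le1 (im (zn n)).
  have := cos_geN1 (im (zn n)) => c1 s1 c2 cs.
  have k1 : 1 <= sin (im (zn n)) - cos (im (zn n)) by nra.
  have k2 : q <= expR (- re (zn n)) by rewrite ler_expR lerN2.
  rewrite fS Re_f Im_f -natr1 mulrDl mul1r; set r := expR (- re (zn n)) in k2 *.
  by split; nra.
have [n hN] := archimedean (re z + im z) q0.
have [_] := key n; have := x0 n; have := yb n; lra.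
Qed.

Fixpoint returns n z : nat :=
  if n is m.+1 then ((re z < 0)%R + returns m (folded_f z))%N else 0%N.

Lemma returnsD m n z : returns (m + n) z = (returns m z + returns n (iter m folded_f z))%N.
Proof. by elim: m z => //= m IH z; rewrite IH -iterSr iterS addnA. Qed.

Lemma returns_unbounded z N : julia_orbit z -> exists2 n, (0 < n)%N & (N <= returns n z)%N.
Proof.
move=> Jz; elim: N => [|N [n n0 hn]]; first by exists 1%N.
have [j hj] := julia_orbit_return (julia_orbit_iter n Jz).
exists (n + (j + 1))%N; first by rewrite addn_gt0 n0.
rewrite returnsD returnsD /= hj !addn0 addnA addn1 ltnS.
by apply: leq_trans hn _; exact: leq_addr.
Qed.

Definition word (s : seq bool) w : C := foldr hbranch w s.

Lemma word_cat s t w : word (s ++ t) w = word s (word t w).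
Proof. exact: foldr_cat. Qed.

Lemma word_half_julia s w : half_julia w -> half_julia (word s w).
Proof. by move=> h; elim: s => //= b s IH; exact: hbranch_half_julia. Qed.

Lemma iter_word s w : half_julia w -> iter (size s) folded_f (word s w) = w.
Proof.
move=> h; elim: s => // b s IH; rewrite /= -iterS iterSr folded_f_hbranch //.
exact: word_half_julia.
Qed.

Lemma iter_word_half_julia s k w : half_julia w -> (k <= size s)%N ->
  half_julia (iter k folded_f (word s w)).
Proof.
move=> h; elim: s k => [|b s IH] [|k] //= hk; first exact: hbranch_half_julia (word_half_julia _ h).
rewrite -iterS iterSr folded_f_hbranch; first exact: IH.
exact: word_half_julia.
Qed.

(** The letter says which of the two inverse branches leads back to the point
    from its image. *)
Fixpoint itinerary n z : seq bool :=
  if n is m.+1 then (im (f z) < 0) :: itinerary m (folded_f z) else [::].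

Lemma word_itinerary n z : julia_orbit z -> word (itinerary n z) (iter n folded_f z) = z.
Proof.
elim: n z => //= n IH z Jz; rewrite -iterS iterSr IH; last exact: (julia_orbit_iter 1).
by rewrite -hbranch_folded_f //; [exact: (Jz 0%N)|exact: (Jz 1%N)].
Qed.

Lemma word_loc_lip1 s w : half_julia w -> loc_lip (word s) 1 w.
Proof.
move=> Xw; elim: s => [|b s IH].
  by exists 1 => // w' _ _; rewrite mul1r.
rewrite -[1]mulr1; apply: (@loc_lip_comp (word s) (hbranch b)) => //.
  exact: word_half_julia.
by apply: hbranch_loc_lip1; exact: word_half_julia.
Qed.

Definition dist1 z w : R := `|re z - re w| + `|im z - im w|.

Lemma word_nonexpanding s a b : half_julia a -> half_julia b ->
  modulus (word s b - word s a) <= dist1 b a.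
Proof.
move=> Xa Xb; rewrite -[leRHS]mul1r; apply: path_lipschitz => // w Xw _ _.
exact: word_loc_lip1.
Qed.

Definition box z (r : R) : set C := [set w | `|re w - re z| <= r /\ `|im w - im z| <= r].

Lemma box_between z r a b w : box z r a -> box z r b ->
  between (re a) (re b) (re w) -> between (im a) (im b) (im w) -> box z r w.
Proof.
have aux (c x y t : R) : `|x - c| <= r -> `|y - c| <= r -> between x y t -> `|t - c| <= r.
  rewrite /between ge_min le_max !ler_norml => /andP[? ?] /andP[? ?] /andP[].
  by move=> /orP[?|?] /orP[?|?]; apply/andP; split; lra.
by move=> [? ?] [? ?] h1 h2; split; [exact: aux h1|exact: aux h2].
Qed.

Lemma dist1_box z r a b : box z r a -> box z r b -> dist1 a b <= 4 * r.
Proof.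
move=> [a1 a2] [b1 b2]; rewrite /dist1.
have -> : re a - re b = (re a - re z) - (re b - re z) by ring.
have -> : im a - im b = (im a - im z) - (im b - im z) by ring.
have := ler_normB (re a - re z) (re b - re z).
have := ler_normB (im a - im z) (im b - im z); lra.
Qed.

Lemma dist1_le z w : dist1 z w <= 2 * modulus (z - w).
Proof.
by rewrite /dist1 -ReB -ImB; have := abs_Re_le (z - w); have := abs_Im_le (z - w); lra.
Qed.

(** Branches do not expand, so the backward images of b stay within 2 r of the
    orbit of z. At each return of the orbit, the image of b then has real part
    at most 2 r, and the branch contributes a factor 1/k. *)
Lemma itinerary_loc_lip r k n z b : 0 <= r -> 1 < k ->
  (forall z, half_julia z -> half_julia (folded_f z) -> re z <= 2 * r -> k < modulus (fderiv z)) ->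
  julia_orbit z -> half_julia b -> box (iter n folded_f z) r b ->
  loc_lip (word (itinerary n z)) (k^-1 ^+ returns n z) b.
Proof.
move=> r0 k1 hk; have k0 : 0 < k by lra.
have ki : 0 <= k^-1 by rewrite invr_ge0 ltW.
elim: n z b => [|n IH] z b Jz Xb hb; first by rewrite expr0; exact: (@word_loc_lip1 [::]).
have JF := julia_orbit_iter 1 Jz.
have hb' : box (iter n folded_f (folded_f z)) r b by rewrite -iterSr.
rewrite /= exprD; apply: (@loc_lip_comp (word (itinerary n (folded_f z))) (hbranch _)) => //.
- exact: word_half_julia.
- exact: exprn_ge0.
- exact: exprn_ge0.
- exact: IH.
set b1 := word _ b; have Xb1 : half_julia b1 by exact: word_half_julia.
have [x0|x0] := boolP (re z < 0); last by rewrite expr0; exact: hbranch_loc_lip1.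
rewrite expr1; apply: hbranch_loc_lip => //; apply: hk.
- exact: hbranch_half_julia.
- by rewrite folded_f_hbranch.
have := word_nonexpanding (itinerary n.+1 z) (Jz n.+1) Xb; rewrite word_itinerary //.
have [h1 h2] := hb; have : dist1 b (iter n.+1 folded_f z) <= 2 * r by rewrite /dist1; lra.
have := abs_Re_le (word (itinerary n.+1 z) b - z); rewrite ReB /= -/b1.
have := ler_norm (re (hbranch (im (f z) < 0) b1) - re z); lra.
Qed.

Lemma bernoulli (a : R) n : 0 <= a -> 1 + n%:R * a <= (1 + a) ^+ n.
Proof.
move=> a0; elim: n => [|n IH]; first by rewrite expr0 mul0r addr0.
rewrite exprS -natr1; have := ler0n R n => h; have := ler_wpM2l (_ : 0 <= 1 + a) IH.
by move=> /(_ (addr_ge0 ler01 a0)); nra.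
Qed.

Lemma itinerary_contracts z r e : julia_orbit z -> 0 <= r -> 0 < e ->
  exists2 n, (0 < n)%N & exists2 l : R, 0 <= l <= e &
    forall b, half_julia b -> box (iter n folded_f z) r b -> loc_lip (word (itinerary n z)) l b.
Proof.
move=> Jz r0 e0; have [k' k1' hk'] := fderiv_uniform (2 * r).
pose k := (1 + k') / 2; have k1 : 1 < k by rewrite /k; lra.
have hk y : half_julia y -> half_julia (folded_f y) -> re y <= 2 * r -> k < modulus (fderiv y).
  by move=> a b c; apply: lt_le_trans (hk' y a b c); rewrite /k; lra.
have [N hN] : exists N : nat, e^-1 < N%:R * (k - 1) by apply: archimedean; lra.
have [n n0 hn] := returns_unbounded N Jz; exists n => //.
exists (k^-1 ^+ returns n z); last by move=> b Xb hb; exact: itinerary_loc_lip hb.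
have k0 : 0 < k by lra.
apply/andP; split; first by rewrite exprn_ge0 // invr_ge0 ltW.
rewrite exprVn -[leRHS]invrK lef_pV2 ?posrE ?invr_gt0 ?exprn_gt0 //.
have := @bernoulli (k - 1) (returns n z); rewrite subrKC.
move=> h; apply: le_trans (h _); last by lra.
have : N%:R * (k - 1) <= (returns n z)%:R * (k - 1) by rewrite ler_pM2r ?ler_nat //; lra.
lra.
Qed.

(** * Backward orbits *)

Lemma discrete_ivt (u : nat -> R) (c t : R) : (forall n, `|u n.+1 - u n| <= c) ->
  u 0%N <= t -> (forall B, exists n, B < u n) -> exists n, `|u n - t| <= c.
Proof.
move=> hu u0 ub; have [n hn] := ub t.
elim: n hn => [|n IH] hn; first by lra.
have [le|lt] := leP (u n) t; last exact: IH.
exists n.+1; have := hu n; rewrite !ler_norml => /andP[h1 h2]; apply/andP; split; lra.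
Qed.

(** The backward orbit a_n under the non-conjugating branch drifts to +oo, and
    its images under the other branch drift to -oo, both with bounded steps
    because the branches do not expand. Together they come within bounded
    distance of every abscissa. *)
Section Dense.
Variable z : C.
Hypothesis Xz : half_julia z.

Let a n : C := word (nseq n false) z.
Let Xa n : half_julia (a n). Proof. exact: word_half_julia. Qed.
Let c := dist1 (hbranch false z) z.

Lemma backward_orbit_step s n :
  `|re (word s (a n.+1)) - re (word s (a n))| <= c.
Proof.
rewrite -ReB; apply: le_trans (abs_Re_le _) _.
have -> : a n.+1 = word (nseq n false) (hbranch false z).
  by rewrite /a -addn1 nseqD word_cat.
by rewrite -!word_cat; apply: word_nonexpanding => //; exact: hbranch_half_julia.
Qed.

(** Backwards, y increases, hence stays above some y0, and x + m y increases
    at each step by exp(-x) (m sin y - cos y). For a suitable m the last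
    factor is at least 1 on [y0, pi], so a bound on x would make y unbounded. *)
Lemma backward_orbit_Re_unbounded B : exists n, B < re (a n).
Proof.
apply: contrapT => hn; have xB n : re (a n) <= B.
  by rewrite leNgt; apply/negP => h; apply: hn; exists n.
have fa n : f (a n.+1) = a n by rewrite /a /= f_hbranch //; exact: Xa.
have yb n : 0 < im (a n) <= pi by case: (Xa n).
have p0 := pi_gt0 R.
pose y0 := Num.min (im (a 0%N)) (pi / 2).
have hy0 : 0 < y0 <= pi / 2.
  by case/andP: (yb 0%N) => h _; rewrite lt_min ge_min lexx orbT h divr_gt0.
have s0 : 0 < sin y0 by apply: sin_gt0_pi; lra.
(* For y <= pi/2 this m gives m sin y >= 2; for y >= pi/2 one uses m >= 1 and
   sin y + |cos y| >= 1. *)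
have s1 := sin_le1 y0; pose m := 2 / sin y0.
have m2 : 2 <= m by rewrite ler_pdivlMr //; lra.
have ms : m * sin y0 = 2 by rewrite divfK // lt0r_neq0.
pose q := expR (- B); have q0 : 0 < q := expR_gt0 _.
have key n : y0 <= im (a n) /\
    re (a 0%N) + m * im (a 0%N) + n%:R * q <= re (a n) + m * im (a n).
  elim: n => [|n [IH1 IH2]]; first by rewrite mul0r addr0 lexx ge_min lexx.
  have := fa n => /(congr1 (fun z => (re z, im z)))[]; rewrite Re_f Im_f.
  have qr : q <= expR (- re (a n.+1)) by rewrite ler_expR lerN2.
  have hy := yb n.+1; set x := re (a n.+1) in qr *; set y := im (a n.+1) in hy *.
  have sy : 0 <= sin y by apply: sin_ge0_pi; lra.
  move: qr; set r := expR (- x) => qr h1 h2.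
  have yy : y0 <= y by nra.
  split => //.
  have k : 1 <= m * sin y - cos y.
    have [le|lt] := leP y (pi / 2).
      have : sin y0 <= sin y.
        by rewrite leNgt; apply/negP; rewrite ltr_sin ?in_itv /=; lra.
      by have := cos_le1 y; nra.
    have : cos y <= 0.
      by rewrite -(cos_pihalf R) leNgt; apply/negP; rewrite ltr_cos ?in_itv /=; lra.
    have := cos2Dsin2 y; have := cos_geN1 y; have := sin_le1 y; nra.
  have k2 : q <= r * (m * sin y - cos y) by nra.
  by rewrite -natr1 mulrDl mul1r; nra.
have [n hN] := @archimedean (B + m * pi - (re (a 0%N) + m * im (a 0%N))) _ q0.
have [_] := key n; have := xB n; have := yb n; nra.
Qed.

(** If f z is the conjugate of a_n with z in the upper half, then exp(-x) sin
    y > y, so x < 0, and then exp(-x) >= Re a_n - x > Re a_n. *)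
Lemma left_backward_orbit_Re_unbounded B : exists n, B < - re (word [:: true] (a n)).
Proof.
have [n hn] := backward_orbit_Re_unbounded (expR B); exists n; rewrite /= ltrNr.
have := f_hbranch true (Xa n); have [/andP[y0 yp] _] := hbranch_half_julia true (Xa n).
set w := hbranch true (a n) in y0 yp *.
move=> /(congr1 (fun z => (re z, im z)))[]; rewrite Re_f Im_f Re_conj Im_conj.
have [/andP[ya _] _] := Xa n; have e0 := expR_gt0 (- re w).
have s0 : 0 <= sin (im w) by apply: sin_ge0_pi; lra.
have s1 : sin (im w) <= im w by apply: sin_le_id; lra.
move=> h1 h2; have e1 : 1 < expR (- re w) by rewrite ltNge; apply/negP => h; nra.
have x0 : re w < 0 by rewrite expR_gt1 in e1; lra.
have := cos_le1 (im w) => c1; rewrite ltrNr -ltr_expR; nra.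
Qed.

Lemma backward_orbit_Re_dense : exists2 c : R, 0 <= c &
  forall t, exists s, `|re (word s z) - t| <= c.
Proof.
pose x0 := re (a 0%N); pose w0 := re (word [:: true] (a 0%N)).
have c0 : 0 <= c by rewrite /c /dist1 addr_ge0.
exists (c + `|x0 - w0|) => [|t]; first by rewrite addr_ge0.
have n0 := normr_ge0 (x0 - w0).
have [le|lt] := leP x0 t.
  have [n hn] := discrete_ivt (backward_orbit_step [::]) le backward_orbit_Re_unbounded.
  by exists (nseq n false); apply: le_trans hn _; lra.
have [lt2|le2] := ltP w0 t.
  exists [::]; rewrite -[word [::] z]/(a 0%N) -/x0.
  by have := ler_norm (x0 - w0); rewrite (gtr0_norm (_ : 0 < x0 - t)); lra.
have [n|||n hn] := @discrete_ivt (fun n => - re (word [:: true] (a n))) c (- t).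
- by rewrite -opprD normrN; exact: backward_orbit_step.
- by rewrite lerN2.
- exact: left_backward_orbit_Re_unbounded.
exists (true :: nseq n false).
by move: hn; rewrite -opprD normrN => hn; apply: le_trans hn _; lra.
Qed.

End Dense.

(** * Periodic points near a given orbit *)

Lemma julia_box_compact z (r : R) : half_julia z -> r < im z ->
  compact (box z r `&` half_julia).
Proof.
move=> Xz rz; pose K := rect (re z - r) (re z + r) (im z - r) (Num.min pi (im z + r)).
have -> : box z r `&` half_julia = K `&` [set w | reexp w <= 1 / 2].
  apply/seteqP; split=> w.
    move=> [[]]; rewrite !ler_norml => /andP[? ?] /andP[? ?] [/andP[? ?] ?].
    split => //; split; apply/andP; split; rewrite ?le_min; lra.
  move=> [[]]; rewrite le_min => /andP[? ?] /andP[? /andP[? ?]] ?.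
  split; last by split => //; apply/andP; split; lra.
  by split; rewrite ler_norml; apply/andP; split; lra.
apply: compact_closedI; first exact: rect_compact.
apply: (@preimage_closed _ _ reexp [set x | x <= 1 / 2]); last exact: closed_le.
by move=> w _; exact: continuous_reexp.
Qed.

(** A point of least displacement exists by compactness, and the contraction
    would decrease its displacement if it were not fixed. *)
Lemma contraction_fixed_point (K : set C) (g : C -> C) (l : R) : compact K -> K !=set0 ->
  (forall w, K w -> K (g w)) -> 0 <= l < 1 ->
  (forall w w', K w -> K w' -> modulus (g w' - g w) <= l * modulus (w' - w)) ->
  exists2 p, K p & g p = p.
Proof.
move=> cK K0 gK /andP[l0 l1] hg; pose d w := modulus (g w - w).
have cd : {within K, continuous d}.
  apply/subspace_continuousP => w Kw; apply/cvgrPdist_lt => e e0.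
  rewrite /prop_near1 /within /=; apply/nbhs_modulusP; exists (e / 2); first by lra.
  move=> w' hw' Kw'; have h := hg _ _ Kw Kw'; have m := modulus_ge0 (w' - w).
  have t1 : d w <= d w' + modulus (g w' - g w) + modulus (w' - w).
    rewrite /d (_ : g w - w = (g w' - w') + (g w - g w') + (w' - w)); last by ring.
    apply: le_trans (modulusD _ _) _; rewrite lerD2r.
    by apply: le_trans (modulusD _ _) _; rewrite lerD2l modulusB.
  have t2 : d w' <= d w + modulus (g w' - g w) + modulus (w' - w).
    rewrite /d (_ : g w' - w' = (g w - w) + (g w' - g w) + (w - w')); last by ring.
    rewrite (modulusB w' w).
    apply: le_trans (modulusD _ _) _; rewrite lerD2r; exact: modulusD.
  by rewrite ltr_norml; apply/andP; split; nra.
have [p] := compact_EVT_min K0 cK cd; rewrite inE => Kp hp; exists p => //.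
have := hp (g p); rewrite inE => /(_ (gK _ Kp)) h1.
have h2 := hg _ _ Kp (gK _ Kp); have m := modulus_ge0 (g p - p).
have : modulus (g p - p) = 0 by rewrite /d in h1; nra.
by move=> /modulus_eq0/eqP; rewrite subr_eq0 => /eqP.
Qed.

Lemma julia_orbit_periodic N p : (0 < N)%N -> iter N folded_f p = p ->
  (forall k, (k < N)%N -> half_julia (iter k folded_f p)) -> julia_orbit p.
Proof.
move=> N0 hp h; elim/ltn_ind => k IH; have [|le] := ltnP k N; first exact: h.
rewrite -(subnK le) iterD hp; apply: IH.
by rewrite -{2}(subn0 k) ltn_sub2l // (leq_trans N0).
Qed.

(** A word s brings the box K around z within distance r' of the n-th point of
    the orbit of z, and the first n inverse branches along the orbit contract
    that neighbourhood into K. *)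
Lemma periodic_near z e : julia_orbit z -> 0 < e -> exists p, exists2 N, (0 < N)%N &
  [/\ julia_orbit p, iter N folded_f p = p & modulus (p - z) < e].
Proof.
move=> Jz e0; have Xz := Jz 0%N; have [/andP[y0 yp] _] := Xz; rewrite /= in y0 yp.
(* The box must avoid the real axis for K to be compact. *)
pose r := Num.min (e / 4) (im z / 2).
have r0 : 0 < r by rewrite lt_min !divr_gt0.
have r1 : r <= e / 4 by rewrite ge_min lexx.
have r2 : r < im z.
  have : r <= im z / 2 by rewrite ge_min lexx orbT.
  by lra.
have [c c0 hc] := backward_orbit_Re_dense Xz.
pose r' := c + 4 * r + pi; have p0 := pi_gt0 R; have r'0 : 0 < r' by rewrite /r'; lra.
pose e' := Num.min (1 / 4) (r / (4 * r')).
have r4 : 0 < 4 * r' by lra.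
have e'0 : 0 < e' by rewrite lt_min (divr_gt0 r0 r4) andbT; lra.
have [n n0 [l /andP[l0 le'] hl]] := itinerary_contracts Jz (ltW r'0) e'0.
have l1 : l <= 1 / 4 by apply: le_trans le' _; rewrite ge_min lexx.
have l2 : l * (4 * r') <= r.
  by rewrite -ler_pdivlMr //; apply: le_trans le' _; rewrite ge_min lexx orbT.
have [s hs] := hc (re (iter n folded_f z)).
pose K := box z r `&` half_julia.
have Kz : K z by split => //; rewrite /box /= !subrr normr0 ltW.
have in_box w : K w -> box (iter n folded_f z) r' (word s w).
  move=> [bw Xw]; have bz := Kz.1; have := word_nonexpanding s Xz Xw.
  have := dist1_box bw bz => h1 h2; have Xs := word_half_julia s Xw.
  have [/andP[? ?] _] := Xs; have [/andP[? ?] _] := Jz n.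
  have := abs_Re_le (word s w - word s z); rewrite ReB !ler_norml => /andP[? ?].
  move: hs; rewrite ler_norml => /andP[? ?].
  by split; rewrite ler_norml /r'; apply/andP; split; lra.
pose g := word (itinerary n z) \o word s.
have gK w : K w -> K (g w).
  move=> Kw; have Xs := word_half_julia s Kw.2; have bs := in_box _ Kw.
  have Xg : half_julia (g w) by exact: word_half_julia.
  have bn : box (iter n folded_f z) r' (iter n folded_f z) by rewrite /box /= !subrr normr0 ltW.
  have := @path_lipschitz (word (itinerary n z)) l _ _ (Jz n) Xs l0.
  rewrite word_itinerary // => /(_ _)h.
  have {}h : modulus (g w - z) <= l * dist1 (word s w) (iter n folded_f z).
    by apply: h => x Xx h1 h2; apply: hl => //; exact: box_between h1 h2.
  have h3 : modulus (g w - z) <= r.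
    apply: le_trans h _; apply: le_trans l2; rewrite ler_wpM2l //; exact: dist1_box bs bn.
  by split => //; split; rewrite -?ReB -?ImB; apply: le_trans h3; [exact: abs_Re_le|exact: abs_Im_le].
(* The paths between points of K stay in K, where g has local constant l <=
   1/4. *)
have gL w w' : K w -> K w' -> modulus (g w' - g w) <= 1 / 2 * modulus (w' - w).
  move=> Kw Kw'; have h : modulus (g w' - g w) <= l * dist1 w' w.
    apply: path_lipschitz => //; [exact: Kw.2|exact: Kw'.2|] => x Xx h1 h2.
    have Kx : K x by split => //; exact: box_between Kw.1 Kw'.1 h1 h2.
    rewrite -[l]mulr1; apply: loc_lip_comp => //; first exact: word_half_julia.
      exact: word_loc_lip1.
    by apply: hl; [exact: word_half_julia|exact: in_box].
  by have := dist1_le w' w; have := modulus_ge0 (w' - w); nra.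
have cK : compact K by exact: julia_box_compact.
have h12 : 0 <= (1 / 2 : R) < 1 by apply/andP; split; lra.
have [p Kp gp] := contraction_fixed_point cK (ex_intro _ z Kz) gK h12 gL.
have Wp : word (itinerary n z ++ s) p = p by rewrite word_cat.
have Xp := Kp.2; exists p, (size (itinerary n z ++ s)).
  by rewrite size_cat addn_gt0; case: (n) n0.
have itp : iter (size (itinerary n z ++ s)) folded_f p = p by rewrite -{1}Wp iter_word.
split => //.
  apply: (@julia_orbit_periodic (size (itinerary n z ++ s))) => //.
    by rewrite size_cat addn_gt0; case: (n) n0.
  by move=> k /ltnW hk; rewrite -Wp; exact: iter_word_half_julia.
have := dist1_box Kp.1 Kz.1; have [b1 b2] := Kp.1.
by have := modulus_le (p - z); rewrite ReB ImB; lra.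
Qed.

(** * The basin and its frontier *)

Fixpoint basin_upto n : set C :=
  if n is m.+1 then [set z | `|im z| < pi /\ basin_upto m (f z)] else petal.

Definition basin : set C := [set z | exists n, basin_upto n z].

Lemma basin_upto_im n z : basin_upto n z -> `|im z| < pi.
Proof. by case: n => [|n] [] // h _; have := pi_gt0 R; lra. Qed.

Lemma basin_uptoS n z : basin_upto n z -> basin_upto n.+1 z.
Proof.
elim: n z => [|n IH] z h; split; first exact: (@basin_upto_im 0).
- exact: (petal_iter 1).
- by case: h.
- by apply: IH; case: h.
Qed.

Lemma basin_upto_f n z : basin_upto n z -> basin_upto n (f z).
Proof. by case: n => [|n]; [exact: (petal_iter 1)|move=> [_ /basin_uptoS]]. Qed.

Lemma basin_upto_conj n z : basin_upto n z -> basin_upto n z^*.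
Proof.
elim: n z => [|n IH] z; first exact: petal_conj.
by move=> [h1 h2]; split; rewrite ?Im_conj ?normrN // f_conj; exact: IH.
Qed.

Lemma basin_im z : basin z -> `|im z| < pi.
Proof. by move=> [n /basin_upto_im]. Qed.

Lemma basin_f z : basin z -> basin (f z).
Proof. by move=> [n /basin_upto_f]; exists n. Qed.

Lemma basin_back z : `|im z| < pi -> basin (f z) -> basin z.
Proof. by move=> h [n hn]; exists n.+1. Qed.

Lemma basin_conj z : basin z -> basin z^*.
Proof. by move=> [n /basin_upto_conj]; exists n. Qed.

Lemma real_basin z : im z = 0 -> basin z.
Proof.
by move=> h; exists 1%N; split; [rewrite h normr0 pi_gt0|exact: real_f_petal].
Qed.

Lemma basin_upto_iter n z : basin_upto n z -> petal (iter n (@f R) z).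
Proof. by elim: n z => // n IH z [_ /IH]; rewrite -iterSr. Qed.

Lemma abs_Im_continuous : continuous (fun z : C => `|im z|).
Proof.
move=> z; apply: (@continuous_comp C R R im (fun x => `|x|)); first exact: Im_continuous.
exact: norm_continuous.
Qed.

Lemma open_abs_Im_lt (a : R) : open [set z : C | `|im z| < a].
Proof.
apply: (@open_comp _ _ (fun z : C => `|im z|) [set x | x < a]); last exact: open_lt.
by move=> z _; exact: abs_Im_continuous.
Qed.

Lemma open_reexp_gt (a : R) : open [set z : C | a < reexp z].
Proof.
apply: (@open_comp _ _ reexp [set x | a < x]); last exact: open_gt.
by move=> z _; exact: continuous_reexp.
Qed.

Lemma open_basin_upto n : open (basin_upto n).
Proof.
elim: n => [|n IH].
  apply: (@openI C [set z | `|im z| < pi / 2] [set z | 1 / 2 < reexp z]).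
    exact: open_abs_Im_lt.
  exact: open_reexp_gt.
apply: (@openI C [set z | `|im z| < pi] (@f R @^-1` basin_upto n)).
  exact: open_abs_Im_lt.
apply: (@open_comp _ _ (@f R)) => //.
by move=> z _; exact: continuous_f.
Qed.

Lemma open_basin : open basin.
Proof.
have -> : basin = \bigcup_n basin_upto n.
  by apply/seteqP; split=> z [n]; [exists n|exists n].
by apply: bigcup_open => n _; exact: open_basin_upto.
Qed.

Lemma fold_conj w : fold w^* = fold w.
Proof.
apply/eqP; rewrite eq_complex !Re_fold !Im_fold Re_conj Im_conj normrN.
by rewrite !eqxx.
Qed.

Lemma folded_f_fold w : folded_f (fold w) = fold (f w).
Proof. by rewrite /folded_f {2}/fold; case: ifP => // _; rewrite f_conj fold_conj. Qed.

Lemma iter_folded_f_fold n w : iter n folded_f (fold w) = fold (iter n (@f R) w).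
Proof. by elim: n => //= n ->; rewrite folded_f_fold. Qed.

Lemma fold_upper w : 0 <= im w -> fold w = w.
Proof. by rewrite /fold => ->. Qed.

Lemma foldP w : w = fold w \/ w = (fold w)^*.
Proof. by rewrite /fold; case: ifP => _; [left|right; rewrite conjcK]. Qed.

Lemma basin_fold w : basin (fold w) <-> basin w.
Proof.
rewrite /fold; case: ifP => // _; split; last exact: basin_conj.
by move=> /basin_conj; rewrite conjcK.
Qed.

Lemma julia_orbit_fold z : julia_orbit z -> fold z = z.
Proof. by move=> /(_ 0%N)[/andP[/ltW h _] _]; exact: fold_upper. Qed.

Lemma julia_orbit_not_basin z : julia_orbit z -> ~ basin z.
Proof.
move=> Jz [n /basin_upto_iter hp]; have := Jz n.
by rewrite -(julia_orbit_fold Jz) iter_folded_f_fold => /half_julia_fold_petal.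
Qed.

Lemma abs_Im_top z : `|im z| = pi -> `|im (f z)| = pi.
Proof.
rewrite Im_f => h; suff -> : sin (im z) = 0 by rewrite mulr0 subr0.
have := sin_sg (im z) `|im z|; rewrite -numEsg h sinpi mulr0.
by [].
Qed.

Lemma closure_basin_iter k z : closure basin z -> `|im (iter k (@f R) z)| <= pi.
Proof.
have cl : closed [set z : C | `|im (iter k (@f R) z)| <= pi].
  apply: (@preimage_closed _ _ (fun z : C => `|im (iter k (@f R) z)|) [set x | x <= pi]); last exact: closed_le.
  move=> w _; apply: (@continuous_comp C C R (iter k (@f R)) (fun z : C => `|im z|)).
    exact: continuous_iter_f.
  exact: abs_Im_continuous.
have : basin `<=` [set z : C | `|im (iter k (@f R) z)| <= pi].
  move=> w hw /=; apply/ltW/basin_im; elim: k {cl} => //= k; exact: basin_f.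
by move=> /closureS h /h; rewrite -(closure_id _).1.
Qed.

(** Orbits of points in the closure of the basin stay in the closed strip. A
    first entry into the basin would come from a point of the boundary lines,
    which never leave these lines. *)
Lemma frontier_julia_orbit z : closure basin z -> ~ basin z -> julia_orbit (fold z).
Proof.
move=> clz nz; have nk k : ~ basin (iter k (@f R) z).
  elim: k => //= k IH hf; apply: IH; apply: basin_back => //.
  rewrite lt_neqAle closure_basin_iter // andbT; apply/eqP => /abs_Im_top h.
  by have := basin_im hf; rewrite h ltxx.
move=> k; rewrite iter_folded_f_fold; set w := iter k _ z; have hw := nk k.
have hs : upper_strip (fold w).
  rewrite /upper_strip /= Im_fold closure_basin_iter // andbT normr_gt0.
  by apply/eqP => h; apply: hw; exact: real_basin.
split => //; rewrite leNgt; apply/negP => hA; apply: hw; apply/basin_fold.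
by exists 0%N; split => //; apply: upper_petal => //; exact: ltW.
Qed.

(** Below a point of [half_julia] there is, still in [half_julia], either a
    point near the real axis, which is in the open basin, or a point of the
    boundary of the petal, which is mapped into the petal. *)
Lemma basin_vertical z : half_julia z ->
  exists y, [/\ 0 < y, y <= im z, half_julia (re z +i* y) & basin (re z +i* y)].
Proof.
move=> Xz; have [/andP[y0 yp] hA] := Xz; have e0 := expR_gt0 (re z).
have [le|lt] := leP (expR (re z)) (1 / 2).
  have hb : nbhs (re z +i* 0) basin.
    by apply: open_nbhs_nbhs; split; [exact: open_basin|exact: real_basin].
  have [d d0 hd] := (nbhs_modulusP _ _).1 hb.
  pose y := Num.min (d / 2) (im z).
  have yy : 0 < y by rewrite lt_min y0 andbT; lra.
  have y1 : y <= im z by rewrite ge_min lexx orbT.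
  exists y; split => //; last first.
    apply: hd; rewrite modulusE /= subrr expr0n add0r subr0 sqrtr_sqr gtr0_norm //.
    by rewrite (@le_lt_trans _ _ (d / 2)) ?ge_min ?lexx //; lra.
  split; first by rewrite /upper_strip /= yy; lra.
  by rewrite /reexp /=; have := cos_le1 y; nra.
pose t := (1 / 2) / expR (re z).
have t0 : 0 < t by rewrite divr_gt0 //; lra.
have t1 : t < 1 by rewrite ltr_pdivrMr; lra.
have te : expR (re z) * t = 1 / 2 by rewrite mulrC divfK // gt_eqF.
have ct : cos (acos t) = t by apply: acosK; rewrite in_itv /=; lra.
have at0 : 0 < acos t by apply: acos_gt0; lra.
have atp : acos t <= pi by apply: acos_lepi; lra.
have le : acos t <= im z.
  rewrite leNgt; apply/negP => h.
  have : cos (acos t) < cos (im z) by rewrite ltr_cos ?in_itv /=; lra.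
  by rewrite ct; move: hA; rewrite /reexp; nra.
have hs : upper_strip (re z +i* acos t) by rewrite /upper_strip /= at0.
have hr : reexp (re z +i* acos t) = 1 / 2 by rewrite /reexp /= ct.
exists (acos t); split => //; first by split; rewrite // hr.
have hp : `|im (re z +i* acos t)| < pi / 2 by apply: upper_petal => //; rewrite hr.
exists 1%N; split; first by have := pi_gt0 R; lra.
by apply: petal_f; rewrite // hr.
Qed.

Lemma hbranch_basin b w : half_julia w -> basin w -> basin (hbranch b w).
Proof.
move=> Xw hw; have hf := f_hbranch b Xw.
have hb : basin (f (hbranch b w)) by rewrite hf; case: b {hf} => //; exact: basin_conj.
apply: basin_back => //; have [/andP[y0 yp] _] := hbranch_half_julia b Xw.
rewrite gtr0_norm // lt_neqAle yp andbT; apply/eqP => h.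
have := basin_im hb; rewrite abs_Im_top ?ltxx // h gtr0_norm //; exact: pi_gt0.
Qed.

(** Pull a basin point vertically below the n-th point of the orbit back along
    the orbit. *)
Lemma julia_orbit_closure z : julia_orbit z -> closure basin z.
Proof.
move=> Jz; apply/closure_modulusP => e e0; have p0 := pi_gt0 R.
pose e' := e / (4 * pi + 1).
have e'0 : 0 < e' by rewrite divr_gt0; lra.
have ee : e' * (4 * pi) < e.
  have : e' * (4 * pi + 1) = e by rewrite divfK // gt_eqF //; lra.
  by rewrite mulrDr; lra.
have [n n0 [l /andP[l0 le'] hl]] := itinerary_contracts Jz (ltW p0) e'0.
set zn := iter n folded_f z in hl; have Xzn : half_julia zn := Jz n.
have [y [y0 yz Xb hb]] := basin_vertical Xzn; set b := re zn +i* y in Xb hb *.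
have [/andP[_ zp] _] := Xzn.
have bb : box zn pi b.
  by split; rewrite /= ?subrr ?normr0; [exact: ltW|rewrite ler0_norm; lra].
have bz : box zn pi zn by rewrite /box /= !subrr normr0 ltW.
exists (word (itinerary n z) b).
  elim: (itinerary n z) => //= c s IH; apply: hbranch_basin => //; exact: word_half_julia.
have h : modulus (word (itinerary n z) b - word (itinerary n z) zn) <= l * dist1 b zn.
  apply: path_lipschitz => // x Xx h1 h2; apply: hl => //; exact: box_between bz bb h1 h2.
rewrite word_itinerary // in h; apply: le_lt_trans h _.
apply: le_lt_trans (ler_wpM2l l0 (dist1_box bb bz)) _.
by apply: le_lt_trans ee; rewrite ler_pM2r //; lra.
Qed.

(** * Connectedness of the basin *)

Lemma connected_between (A B : set C) : connected A -> A `<=` B -> B `<=` closure A ->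
  connected B.
Proof.
move=> cA AB BA D [x Dx] [G opG DG] [F cF DF].
have AD : A `&` D = A.
  apply: cA.
  - have [Bx Gx] : (B `&` G) x by rewrite -DG.
    have [y [Ay Gy]] := BA x Bx G (open_nbhs_nbhs (conj opG Gx)).
    by exists y; split => //; rewrite DG; split => //; exact: AB.
  - by exists G => //; rewrite DG setIA (setIidl AB).
  - by exists F => //; rewrite DF setIA (setIidl AB).
have AF : A `<=` F by rewrite -AD DF => y [_ []].
rewrite DF; apply/setIidPl => y /BA /(closureS AF).
by rewrite -(closure_id _).1.
Qed.

Lemma segment_component (A : set C) (g : R -> C) (s t : R) : continuous g -> s <= t ->
  (forall r, s <= r <= t -> A (g r)) -> connected_component A (g s) (g t).
Proof.
move=> cg st h; exists (g @` `[s, t]%classic); last first.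
  by exists t => //=; rewrite in_itv /= st lexx.
split.
- by exists s => //=; rewrite in_itv /= st lexx.
- by move=> _ [r /= + <-]; rewrite in_itv /= => /h.
apply: connected_continuous_connected; first exact: segment_connected.
exact: continuous_subspaceT.
Qed.

Definition upper_half (A : set C) : set C := [set z | A z /\ 0 < im z].

(** Moving right stays in the petal, as does moving vertically between two of
    its points: any two points are joined by a horizontal and a vertical
    segment. *)
Lemma upper_petal_connected : connected (upper_half petal).
Proof.
set A := upper_half petal.
have Ain z : A z <-> [/\ 0 < im z, im z < pi / 2 & 1 / 2 < expR (re z) * cos (im z)].
  split=> [[[h1 h2] h3]|[h1 h2 h3]]; first by rewrite gtr0_norm in h1.
  by split => //; split => //; rewrite gtr0_norm.
have conn a b : A a -> A b -> connected_component A a b.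
  wlog le : a b / re a <= re b => [H|].
    have [le|/ltW le] := leP (re a) (re b); first exact: H.
    by move=> Aa Ab; apply: connected_component_sym; exact: H.
  move=> /Ain[a1 a2 a3] /Ain[b1 b2 b3]; have p0 := pi_gt0 R.
  have e0 := expR_gt0 (re a); have e1 : expR (re a) <= expR (re b) by rewrite ler_expR.
  have hor r : re a <= r <= re b -> A (r +i* im a).
    move=> /andP[r1 r2]; apply/Ain; split => //=.
    have : expR (re a) <= expR r by rewrite ler_expR.
    by nra.
  apply: (@connected_component_trans _ _ (re b +i* im a)).
    have ea : re a +i* im a = a by case: (a).
    rewrite -{1}ea; apply: (@segment_component A (fun r => r +i* im a)) => //.
    by apply: continuous_Complex; [move=> ?; exact: cvg_id|exact: cst_continuous].
  have ver (p q : R) : p <= q -> A (re b +i* p) -> A (re b +i* q) ->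
      connected_component A (re b +i* p) (re b +i* q).
    move=> pq /Ain[/= p1 p2 p3] /Ain[/= q1 q2 q3].
    apply: (@segment_component A (fun r => re b +i* r)) => //.
      by apply: continuous_Complex; [exact: cst_continuous|move=> ?; exact: cvg_id].
    move=> r /andP[r1 r2]; apply/Ain; split => /=; try lra.
    have : cos q <= cos r by rewrite leNgt; apply/negP; rewrite ltr_cos ?in_itv /=; lra.
    by nra.
  have Ac : A (re b +i* im a) by apply: hor; rewrite le lexx.
  have Ab : A (re b +i* im b) by apply/Ain.
  have eb : re b +i* im b = b by case: (b).
  have [le2|/ltW le2] := leP (im a) (im b).
    by rewrite -{2}eb; exact: ver.
  by rewrite -{2}eb; apply: connected_component_sym; exact: ver.
(* A base point: exp(1/c) c >= (1 + 1/c) c > 1 for c = cos (pi/4). *)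
have c4 : 0 < cos (pi / 4 : R) by apply: cos_gt0_pihalf; have := pi_gt0 R; lra.
pose z0 : C := (cos (pi / 4))^-1 +i* (pi / 4).
have A1 : A z0.
  apply/Ain => /=; have p0 := pi_gt0 R; split; try lra.
  have := ler_wpM2r (ltW c4) (expR_ge1Dx (cos (pi / 4))^-1).
  by rewrite mulrDl mul1r mulVf ?gt_eqF //; lra.
suff -> : A = connected_component A z0 by exact: component_connected.
apply/seteqP; split; last exact: connected_component_sub.
by move=> z Az; exact: conn.
Qed.

(** Here exp(-x) sin y = y, and sin y = y cos c for some c in (0, y), so
    exp(-x) cos y < exp(-x) cos c = 1 and x <= 0. So points off the real axis
    never map into the slit. *)
Lemma real_image_lt1 z : 0 < im z < pi -> im (f z) = 0 -> re (f z) < 1.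
Proof.
move=> /andP[y0 yp]; rewrite Im_f Re_f => h.
have s0 : 0 < sin (im z) by apply: sin_gt0_pi; rewrite y0.
have [c /andP[c0 cy] sE] := sin_MVT y0.
have c1 : cos (im z) < cos c by rewrite ltr_cos ?in_itv /=; lra.
have e0 := expR_gt0 (- re z); have s1 := sin_le_id (ltW y0).
have ec : expR (- re z) * cos c = 1.
  apply: (mulfI (lt0r_neq0 y0)); rewrite mulr1 mulrCA -sE; lra.
have e1 : 1 <= expR (- re z).
  by rewrite leNgt; apply/negP => lt; have := cos_le1 c; nra.
have : 0 <= - re z by rewrite leNgt; apply/negP; rewrite -expR_lt1; lra.
by nra.
Qed.

Lemma upper_union_connected (A I : set C) : open A -> (forall z, I z -> A z /\ im z = 0) ->
  connected (upper_half A) -> connected (upper_half A `|` I).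
Proof.
move=> oA hI cA; apply: (connected_between cA); first exact: subsetUl.
rewrite subUset; split; first exact: subset_closure.
move=> z /hI[Az iz]; apply/closure_modulusP => e e0.
have [d d0 hd] := (nbhs_modulusP _ _).1 (open_nbhs_nbhs (conj oA Az) : nbhs z A).
pose r := Num.min (e / 2) (d / 2); have r0 : 0 < r by rewrite lt_min; lra.
have r1 : r <= e / 2 by rewrite ge_min lexx.
have r2 : r <= d / 2 by rewrite ge_min lexx orbT.
have m : modulus ((re z +i* r) - z) = r.
  by rewrite modulusE ReB ImB /= iz subrr expr0n add0r subr0 sqrtr_sqr gtr0_norm.
by exists (re z +i* r); [split => //; apply: hd|]; rewrite m; lra.
Qed.

Lemma conj_connected (A : set C) : connected A -> connected (@conjc R @` A).
Proof.
move=> h; apply: connected_continuous_connected => //.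
apply: continuous_subspaceT; exact: conj_continuous.
Qed.

(** The set I glues the upper half of A to its mirror image: real points of
    the open set A are limits of points of its upper half. *)
Lemma symmetric_union_connected (A I : set C) : open A -> (forall z, A z -> A z^*) ->
  (forall z, I z -> A z /\ im z = 0) -> I !=set0 -> connected (upper_half A) ->
  connected [set z | A z /\ (im z = 0 -> I z)].
Proof.
move=> oA cA hI [x Ix] hc; have hU := upper_union_connected oA hI hc.
have Ireal z : I z -> z^* = z.
  by move=> /hI[_]; case: z => a b /= ->; rewrite oppr0.
have -> : [set z | A z /\ (im z = 0 -> I z)] =
    (upper_half A `|` I) `|` @conjc R @` (upper_half A `|` I).
  apply/seteqP; split=> z.
    move=> [Az hz]; have [lt|lt|/hz] := ltgtP (im z) 0.
    - right; exists (z^*); last by rewrite conjcK.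
      by left; split; [exact: cA|rewrite Im_conj; lra].
    - by left; left.
    - by left; right.
  move=> [[[Az lt]|Iz]|[w [[Aw lt]|Iw] <-]].
  - by split => // h; rewrite h ltxx in lt.
  - by have [] := hI z Iz.
  - by split; [exact: cA|rewrite Im_conj => h; lra].
  - by rewrite Ireal //; have [] := hI w Iw.
apply: connectedU => //; last exact: conj_connected.
exists x; split; first by right.
by exists x; [right|exact: Ireal].
Qed.

Lemma zero_basin_upto n : basin_upto n 0.
Proof.
elim: n => [|n IH]; last exact: basin_uptoS.
by rewrite /= /petal /reexp /= normr0 expR0 cos0 mulr1; have := pi_gt0 R; split; lra.
Qed.

(** By [real_image_lt1] the next upper half is the image under [branch] of the
    previous stage minus the slit, which is connected because it is glued
    along its real points below 1. *)
Lemma upper_basin_connected n : connected (upper_half (basin_upto n)).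
Proof.
elim: n => [|n IH]; first exact: upper_petal_connected.
pose I : set C := [set z | basin_upto n z /\ im z = 0 /\ re z < 1].
pose S : set C := [set z | basin_upto n z /\ (im z = 0 -> I z)].
have cS : connected S.
  apply: symmetric_union_connected => //; first exact: open_basin_upto.
  - exact: basin_upto_conj.
  - by move=> z [h1 [h2 _]].
  - by exists 0; split; [exact: zero_basin_upto|rewrite /= ltr01].
have Ss : S `<=` slit_strip.
  move=> z [hz hI]; split; first exact/ltW/(basin_upto_im hz).
  by move=> [/hI[_ [_ lt]]]; rewrite leNgt lt.
have -> : upper_half (basin_upto n.+1) = branch @` S.
  apply/seteqP; split=> z.
    move=> [[hz hf] y0]; rewrite gtr0_norm // in hz.
    exists (f z).
      split => // h; split => //; split => //; apply: real_image_lt1 => //.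
      by rewrite y0.
    apply: branch_unique; first by rewrite /upper_strip /= y0 ltW.
    exact/ltW/(basin_upto_im hf).
  move=> [w Sw <-]; have [/andP[y0 yp] fw] := branchP (Ss _ Sw).
  split => //; split; last by rewrite fw; case: Sw.
  rewrite gtr0_norm // lt_neqAle yp andbT; apply/eqP => h.
  have : `|im w| = pi by rewrite -fw; apply: abs_Im_top; rewrite h gtr0_norm // pi_gt0.
  by move=> h'; have := basin_upto_im Sw.1; rewrite h' ltxx.
apply: connected_continuous_connected => //.
apply/subspace_continuousP => w Sw V /nbhs_modulusP[e e0 hV].
have [d d0 hd] := branch_continuous (Ss _ Sw) e0.
rewrite /within /= ; apply/nbhs_modulusP; exists d => // w' lt Sw'.
by apply: hV; apply: hd => //; exact: Ss.
Qed.

Lemma basin_connected : connected basin.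
Proof.
have -> : basin = \bigcup_n basin_upto n.
  by apply/seteqP; split=> z [n]; [exists n|exists n].
apply: bigcup_connected; first by exists 0 => n _; exact: zero_basin_upto.
move=> n _; pose I : set C := [set z | basin_upto n z /\ im z = 0].
have -> : basin_upto n = [set z | basin_upto n z /\ (im z = 0 -> I z)].
  by apply/seteqP; split=> z; [move=> h|case].
apply: symmetric_union_connected => //.
- exact: open_basin_upto.
- exact: basin_upto_conj.
- by exists 0; split; [exact: zero_basin_upto|].
- exact: upper_basin_connected.
Qed.

(** * The basin is a Baker domain *)

(** Once in the petal, |y| does not increase, so cos y is bounded below and
    exp x grows at a linear rate that is uniform near z. *)
Lemma basin_escape z : basin z -> exists2 V : set C, nbhs z V & forall B : R,
  exists N, forall n w, (N <= n)%N -> V w -> B < modulus (iter n (@f R) w).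
Proof.
move=> [n hn]; have [p1 p2] := basin_upto_iter hn; have p0 := pi_gt0 R.
set p := iter n _ z in p1 p2; pose y1 := (`|im p| + pi / 2) / 2.
have n0 := normr_ge0 (im p); have h1 : `|im p| < y1 by rewrite /y1; lra.
have h2 : y1 < pi / 2 by rewrite /y1; lra.
pose Q : set C := [set w | `|im w| < y1 /\ 1 / 2 < reexp w].
exists (iter n (@f R) @^-1` Q).
  apply: open_nbhs_nbhs; split => //; apply: open_comp => [w _|].
    exact: continuous_iter_f.
  apply: (@openI C [set w | `|im w| < y1] [set w | 1 / 2 < reexp w]).
    exact: open_abs_Im_lt.
  exact: open_reexp_gt.
move=> B; pose c := cos y1; have c0 : 0 < c by apply: cos_gt0_pihalf; lra.
have key k w : Q w -> Q (iter k (@f R) w) /\ k%:R * c <= expR (re (iter k (@f R) w)).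
  move=> Qw; elim: k => [|k [[IH1 IH2] IH3]]; first by rewrite mul0r expR_ge0.
  set q := iter k _ w in IH1 IH2 IH3 *; rewrite iterS -/q.
  have hp : `|im q| < pi / 2 by lra.
  have [k1 k2 k3 k4] := petal_step hp (ltW IH2); have [_ k5] := petal_f hp (ltW IH2).
  split; first by split => //; lra.
  have cc : c <= cos (im q).
    rewrite -[cos (im q)]cos_norm leNgt; apply/negP; have := normr_ge0 (im q) => nq.
    by rewrite ltr_cos ?in_itv /=; lra.
  by rewrite -natr1 mulrDl mul1r; lra.
have [K hK] := archimedean (expR B) c0; exists (K + n)%N => m w le Vw.
have le2 : (n <= m)%N by apply: leq_trans le; exact: leq_addl.
rewrite -(subnK le2) iterD; have [_ kk] := key (m - n)%N _ Vw.
set q := iter (m - n) _ _ in kk *; apply: lt_le_trans (abs_Re_le q).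
apply: lt_le_trans (ler_norm _); rewrite -ltr_expR; apply: lt_le_trans kk.
apply: lt_le_trans hK _; rewrite ler_pM2r // ler_nat.
by rewrite leq_subRL // addnC.
Qed.

Lemma chordal_infty z : chordal_dist (Some z) None = 2 / Num.sqrt (1 + modulus z ^+ 2).
Proof. by []. Qed.

Lemma sqrt_1sqr_gt (m : R) : 0 <= m -> m < Num.sqrt (1 + m ^+ 2).
Proof.
by move=> m0; rewrite -{1}[m]ger0_norm // -sqrtr_sqr ltr_sqrt; have := sqr_ge0 m; lra.
Qed.

Lemma sqrt_1sqr_le (m : R) : 0 <= m -> Num.sqrt (1 + m ^+ 2) <= 1 + m.
Proof.
move=> m0; rewrite -[leRHS]ger0_norm; last by lra.
by rewrite -sqrtr_sqr ler_wsqrtr // sqrrD; lra.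
Qed.

Lemma chordal_infty_lt z (e : R) : 0 < e -> 2 / e < modulus z -> chordal_dist (Some z) None < e.
Proof.
move=> e0; rewrite ltr_pdivrMr // => h; rewrite chordal_infty.
have h1 := sqrt_1sqr_gt (modulus_ge0 z); have := modulus_ge0 z => m0.
by rewrite ltr_pdivrMr; nra.
Qed.

Lemma chordal_far z c : 2 * modulus c + 1 <= modulus z ->
  1 / (2 * (1 + modulus c)) <= chordal_dist (Some z) (Some c).
Proof.
move=> h; have c0 := modulus_ge0 c; have z0 := modulus_ge0 z; rewrite /chordal_dist.
have h1 := sqrt_1sqr_gt z0; have h2 := sqrt_1sqr_gt c0.
have h3 := sqrt_1sqr_le z0; have h4 := sqrt_1sqr_le c0.
have t : modulus z <= modulus (z - c) + modulus c.
  by have := modulusD (z - c) c; rewrite subrK.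
move: h1 h2 h3 h4; set a := Num.sqrt _; set b := Num.sqrt _ => h1 h2 h3 h4.
rewrite ler_pdivlMr; last by rewrite mulr_gt0; lra.
rewrite mul1r mulrC ler_pdivrMr; last by lra.
have ab : a * b <= (1 + modulus z) * (1 + modulus c) by apply: ler_pM; lra.
nra.
Qed.

Lemma basin_iterates_escape (m : nat -> nat) : (forall B, exists N, forall j, (N <= j)%N -> (B <= m j)%N) ->
  cvg_locally_uniformly basin (fun j => iterate_to_sphere (@f R) (m j)) (fun=> None).
Proof.
move=> hm z /basin_escape[V nV hV]; exists V => // e e0.
have [N hN] := hV (2 / e); have [N' hN'] := hm N.
exists N' => // j /= le w _ Vw; apply: chordal_infty_lt => //.
by apply: hN => //; exact: hN'.
Qed.

(** In the definition of normality the sequence of exponents is arbitrary: it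
    has a constant subsequence or tends to infinity. *)
Lemma sequence_dichotomy (m : nat -> nat) :
  (exists c, forall N, exists2 j, (N <= j)%N & m j = c) \/
  (forall B, exists N, forall j, (N <= j)%N -> (B <= m j)%N).
Proof.
have [h|h] := pselect (exists c, forall N, exists2 j, (N <= j)%N & m j = c); [by left|right].
elim=> [|B [N hN]]; first by exists 0%N.
have [N' hN'] : exists N', forall j, (N' <= j)%N -> m j <> B.
  apply: contrapT => hn; apply: h; exists B => N'; apply: contrapT => hj; apply: hn.
  by exists N' => j le e; apply: hj; exists j.
exists (maxn N N') => j; rewrite geq_max => /andP[l1 l2].
by rewrite ltn_neqAle hN // andbT; apply/eqP => e; exact: (hN' j l2).
Qed.

Lemma basin_normal : iterates_normal_on (@f R) basin.
Proof.
move=> m; have [[c hc]|hm] := sequence_dichotomy m; last first.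
  exists id; split; first by [].
  by exists (fun=> None); exact: basin_iterates_escape.
have [g hg] : exists g : nat -> nat, forall N, (N <= g N)%N /\ m (g N) = c.
  have hc' N : exists j, (N <= j)%N /\ m j = c by have [j] := hc N; exists j.
  by exists (fun N => sval (cid (hc' N))) => N; exact: svalP (cid (hc' N)).
pose k := fix k n := if n is n'.+1 then g (k n').+1 else g 0%N.
exists k; split.
  apply: homo_ltn; first exact: ltn_trans.
  by move=> i; have [] := hg (k i).+1.
exists (fun z => Some (iter c (@f R) z)) => z _; exists setT; first exact: filterT.
move=> e e0; exists 0%N => // j _ w _ _ /=.
have -> : m (k j) = c by case: j => [|j]; [have [] := hg 0%N|have [] := hg (k j).+1].
by rewrite /chordal_dist /iterate_to_sphere subrr modulus0 mulr0 mul0r.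
Qed.

Lemma basin_fatou : basin `<=` fatou_set (@f R).
Proof.
by move=> z hz; exists basin; split => //; [exact: open_basin|exact: basin_normal].
Qed.

Lemma periodic_orbit_bounded M p : (0 < M)%N -> iter M (@f R) p = p ->
  exists B : R, forall n, modulus (iter n (@f R) p) <= B.
Proof.
move=> M0 hp; exists (\sum_(i < M) modulus (iter i (@f R) p)) => n.
have -> : iter n (@f R) p = iter (n %% M) (@f R) p.
  rewrite {1}(divn_eq n M) addnC iterD; congr (iter _ _ _).
  by elim: (n %/ M)%N => // q IH; rewrite mulSn iterD IH.
have lt : (n %% M < M)%N by rewrite ltn_mod.
rewrite (bigD1 (Ordinal lt)) //= lerDl; apply: sumr_ge0 => i _; exact: modulus_ge0.
Qed.

(** Unfolded, a periodic point returns to itself or to its conjugate, and in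
    the second case it returns to itself after twice the time. *)
Lemma julia_orbit_fixed M p : julia_orbit p -> iter M folded_f p = p ->
  iter (M + M) (@f R) p = p.
Proof.
move=> Jp hp; have := iter_folded_f_fold M p; rewrite julia_orbit_fold // hp => e.
rewrite iterD; have [hw|hw] := foldP (iter M (@f R) p).
  by rewrite hw -e hw -e.
by rewrite hw -e iter_f_conj hw -e conjcK.
Qed.

Lemma closure_basin_conj z : closure basin z -> closure basin z^*.
Proof.
move=> /closure_modulusP h; apply/closure_modulusP => e /h[w hw lt].
by exists (w^*); [exact: basin_conj|rewrite modulus_conjB].
Qed.

Lemma frontier_periodic z e : closure basin z -> ~ basin z -> 0 < e ->
  exists p, [/\ closure basin p, ~ basin p, periodic_point (@f R) p & modulus (p - z) < e].
Proof.
move=> clz nz e0; have Jz := frontier_julia_orbit clz nz.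
have [p [N N0 [Jp hp lt]]] := periodic_near Jz e0.
have pp : periodic_point (@f R) p.
  by exists (N + N)%N; [rewrite addn_gt0 N0|exact: julia_orbit_fixed].
have [hz|hz] := foldP z.
  exists p; split; [exact: julia_orbit_closure|exact: julia_orbit_not_basin|exact: pp|].
  by rewrite hz.
exists (p^*); split.
- exact/closure_basin_conj/julia_orbit_closure.
- by move=> /basin_conj; rewrite conjcK; exact: julia_orbit_not_basin.
- by have [q q0 hq] := pp; exists q => //; rewrite iter_f_conj hq.
- by rewrite hz modulus_conjB.
Qed.

(** A limit function would be infinite on the basin points of V, hence the
    iterates of all points near a periodic point p of V that is a limit of
    basin points would be uniformly large at some time, while the orbit of p
    is bounded. *)
Lemma frontier_not_normal z (V : set C) : closure basin z -> ~ basin z -> open V -> V z ->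
  ~ iterates_normal_on (@f R) V.
Proof.
move=> clz nz oV Vz hn.
have [d d0 hd] := (nbhs_modulusP _ _).1 (open_nbhs_nbhs (conj oV Vz) : nbhs z V).
have [p [clp np [M M0 hM] lt]] := frontier_periodic clz nz d0; have Vp := hd _ lt.
have [B hB] := periodic_orbit_bounded M0 hM.
have B0 : 0 <= B := le_trans (modulus_ge0 _) (hB 0%N).
have [k [hk [h hh]]] := hn id.
have k_ge j : (j <= k j)%N.
  by elim: j => // j IH; apply: leq_ltn_trans IH _; exact: hk.
(* A finite limit value is at chordal distance bounded below from large
   points. *)
have h_infty u : V u -> basin u -> h u = None.
  move=> Vu hu; have [W nW hW] := hh u Vu; have [W' nW' hW'] := basin_escape hu.
  case E : (h u) => [c|] //; have c0 := modulus_ge0 c.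
  have [|N _ hN] := hW (1 / (2 * (1 + modulus c))); first by rewrite divr_gt0 ?mulr_gt0; lra.
  have [N' hN'] := hW' (2 * modulus c + 1); pose j := maxn N N'.
  have := hN j (leq_maxl _ _) u Vu (nbhs_singleton nW); rewrite E ltNge => /negP[].
  apply: chordal_far; apply/ltW/hN'; last exact: nbhs_singleton.
  by apply: leq_trans (k_ge j); exact: leq_maxr.
have [W /nbhs_modulusP[d1 d10 hd1] hW] := hh p Vp.
pose s := Num.sqrt (1 + (B + 1) ^+ 2).
(* With s = sqrt(1 + (B + 1)^2), points of modulus at most B + 1 are at
   chordal distance at least 2 / s from infinity. *)
have s0 : 0 < s by apply: (@le_lt_trans _ _ (B + 1)); [lra|apply: sqrt_1sqr_gt; lra].
have [|N _ hN] := hW s^-1; first by rewrite invr_gt0.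
have cf : nbhs p [set u | modulus (iter (k N) (@f R) u - iter (k N) (@f R) p) < 1].
  have := @continuous_iter_f (k N) p [set v | modulus (v - iter (k N) (@f R) p) < 1].
  by apply; apply/nbhs_modulusP; exists 1.
have [d2 d20 hd2] := (nbhs_modulusP _ _).1 cf.
have [d3 d30 hd3] := (nbhs_modulusP _ _).1 (open_nbhs_nbhs (conj oV Vp) : nbhs p V).
have [|u hu lu] := (closure_modulusP _ _).1 clp (Num.min d1 (Num.min d2 d3)).
  by rewrite !lt_min d10 d20.
move: lu; rewrite !lt_min => /and3P[l1 l2 l3].
have Vu := hd3 _ l3; have := hN N (leqnn _) u Vu (hd1 _ l1).
rewrite (h_infty u Vu hu) /iterate_to_sphere chordal_infty.
set q := iter (k N) _ u; have hq : modulus q <= B + 1.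
  have := hd2 _ l2; rewrite /= -/q; have := hB (k N).
  by have := modulusD (q - iter (k N) (@f R) p) (iter (k N) (@f R) p); rewrite subrK; lra.
have q0 := modulus_ge0 q.
have qs : Num.sqrt (1 + modulus q ^+ 2) <= s.
  by rewrite ler_wsqrtr // lerD2l ler_sqr // nnegrE; lra.
have qp := le_lt_trans q0 (sqrt_1sqr_gt q0).
rewrite ltr_pdivrMr // mulrC ltr_pdivlMr //; lra.
Qed.

(** In the component of 0, the basin is open, and it is closed because no
    frontier point is in the Fatou set. *)
Lemma basin_component : fatou_component (@f R) basin.
Proof.
have b0 : basin 0 by exists 0%N; exact: zero_basin_upto.
exists 0; first exact: basin_fatou.
apply/seteqP; split.
  apply: connected_component_max => //; [exact: basin_fatou|exact: basin_connected].
set K := connected_component _ _.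
have KF : K `<=` fatou_set (@f R) by exact: connected_component_sub.
have K0 : K 0 by apply: connected_component_refl; exact: basin_fatou.
have E : K `&` basin = K `&` closure basin.
  apply/seteqP; split=> z [Kz hz]; split => //; first exact: subset_closure.
  apply: contrapT => nz; have [V [oV Vz nV]] := KF z Kz.
  exact: (frontier_not_normal hz nz oV Vz nV).
suff -> : K = K `&` basin by move=> z [].
apply/esym; apply: (@component_connected _ (fatou_set (@f R)) 0).
- by exists 0.
- by exists basin => //; exact: open_basin.
- by exists (closure basin) => //; exact: closed_closure.
Qed.

Lemma basin_baker : baker_domain (@f R) basin.
Proof.
split; first exact: basin_component.
  by exists 1%N => //; move=> _ [z hz <-]; exact: basin_f.
by apply: (@basin_iterates_escape id) => B; exists B.
Qed.

Lemma boundary_basin z : boundary basin z <-> closure basin z /\ ~ basin z.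
Proof. by rewrite /boundary /setD /= (interior_id _).1 //; exact: open_basin. Qed.

Lemma boundary_basin_periodic :
  boundary basin `<=` closure (periodic_point (@f R) `&` boundary basin).
Proof.
move=> z /boundary_basin[clz nz]; apply/closure_modulusP => e e0.
have [p [h1 h2 h3 h4]] := frontier_periodic clz nz e0.
by exists p => //; split => //; apply/boundary_basin.
Qed.

End Plane.

Theorem theoremD (R : realType) (U : set R[i])
  (hU : unique
          (fun V : set R[i] => baker_domain (@f R) V /\ V `<=` @strip R) U) :
  boundary U `<=` closure (periodic_point (@f R) `&` boundary U).
Proof.
have -> : U = @basin R.
  have [_ hu] := hU; apply: hu; split; first exact: basin_baker.
  by move=> z /basin_im/ltW.
exact: boundary_basin_periodic.
Qed.
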